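(* Let $c\in\mathbb{R}$ be a constant, $p(n)=\frac{\log n+c+o(1)}{n}$ and $0\le q(n)\le 1$. Then, as $n\to\infty$, $$\mathrm{P}\bigl(G_{n,p(n)}^{q(n)}\in\mathcal{D}^n\bigr)\ \le\ 1-(1-q(n))^2\,e^{-2(1-q(n))e^{-c}}\,e^{-2c}+o(1),$$ that is, the limit superior as $n\to\infty$ of the left-hand side minus the main term on the right-hand side is at most $0$.
   Context: A digraph $G=(V,E)$ on $n$ vertices has $V=\{1,\dots,n\}$ and $E\subseteq V\times V$ (self-loops $(i,i)$ allowed). Its structured matrix $\bar A\in\{0,*\}^{n\times n}$ has $\bar A_{ij}=*$ if $(i,j)\in E$ and $\bar A_{ij}=0$ otherwise. A realization of $\bar A$ is a real matrix obtained by assigning real numbers to the $*$ entries and keeping the zero entries. $G$ (equivalently $\bar A$) is structurally diagonalizable if for almost all (with respect to Lebesgue measure on $\mathbb{R}^{|E|}$) real assignments to the $*$ entries, the resulting matrix is diagonalizable (over $\mathbb{C}$). $\mathcal{D}^n$ is the set of structurally diagonalizable digraphs with $n$ vertices. In the random digraph model $\mathcal{G}(n,p,q)$ on $n$ labeled vertices, each ordered pair $(u,v)$ with $u\ne v$ is an edge with probability $p$, each self-loop $(u,u)$ is present with probability $q$, all independently. $G_{n,p(n)}^{q(n)}$ denotes a random digraph sampled from $\mathcal{G}(n,p(n),q(n))$. *)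

(* Defs.v *)
From HB Require Import structures.
From mathcomp Require Import all_boot all_order all_algebra.
From mathcomp Require Import all_classical all_reals all_analysis.
From mathcomp Require Import complex.

Set Implicit Arguments.
Unset Strict Implicit.
Unset Printing Implicit Defensive.

Import Order.TTheory GRing.Theory Num.Theory.
Import numFieldNormedType.Exports.

Local Open Scope classical_set_scope.
Local Open Scope ring_scope.

Section LebesgueTuple.
Context {R : realType}.

Definition cons_tuple_pair (m : nat) (z : R * m.-tuple R) : m.+1.-tuple R :=
  [tuple of z.1 :: z.2].

(* Lebesgue measure on R^m: the m-fold product of the one-dimensional one, with
   R * R^m identified with R^(m+1). In dimension 0 it is the unit mass of the
   only point, so that "almost all" means "all". *)
Fixpoint lebesgue_tuple (m : nat) : set (m.-tuple R) -> \bar R :=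
  match m with
  | 0%N => \d_([tuple] : 0.-tuple R)
  | k.+1 => pushforward (@lebesgue_measure R \x @lebesgue_tuple k)%E
                        (@cons_tuple_pair k)
  end.

Lemma measurable_cons_tuple_pair m :
  measurable_fun [set: R * m.-tuple R] (@cons_tuple_pair m).
Proof. by apply: measurable_cons. Qed.

Lemma lebesgue_tuple_sigma_finite_measure m :
  [/\ @lebesgue_tuple m set0 = 0%E,
      forall A, (0 <= @lebesgue_tuple m A)%E,
      semi_sigma_additive (@lebesgue_tuple m) &
      sigma_finite setT (@lebesgue_tuple m)].
Proof.
elim: m => [|m [IH0 IHge0 IHs IHf]].
  pose d0 := @dirac _ _ ([tuple] : 0.-tuple R) R.
  split; [exact: (measure0 d0) | exact: (measure_ge0 d0) |
          exact: (@measure_semi_sigma_additive _ _ _ d0) |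
          exact: (@sigma_finiteT _ _ _ d0)].
pose M := isMeasure.Build _ _ _ _ IH0 IHge0 IHs.
pose mu0 : {measure set (m.-tuple R) -> \bar R} := HB.pack (@lebesgue_tuple m) M.
pose S := @Measure_isSigmaFinite.Build _ _ _ mu0 IHf.
pose mu : {sigma_finite_measure set (m.-tuple R) -> \bar R} :=
  HB.pack (@lebesgue_tuple m) M S.
have mc := @measurable_cons_tuple_pair m.
pose push : {measure set (m.+1.-tuple R) -> \bar R} :=
  pushforward (@lebesgue_measure R \x mu)%E (@cons_tuple_pair m).
pose nu := push mc.
split; [exact: (measure0 nu) | exact: (measure_ge0 nu) |
        exact: (@measure_semi_sigma_additive _ _ _ nu) | ].
have /sigma_finiteP[F [FT ndF Foo]] := sigma_finiteT (@lebesgue_measure R).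
have /sigma_finiteP[G [GT ndG Goo]] := sigma_finiteT mu.
pose g (t : m.+1.-tuple R) : R * m.-tuple R := (thead t, [tuple of behead t]).
have gK z : g (cons_tuple_pair z) = z.
  by case: z => x t; congr pair; apply: val_inj.
have mg : measurable_fun setT g.
  by apply: measurable_fun_pair; [exact: measurable_tnth|exact: measurable_behead].
exists (fun i => g @^-1` (F i `*` G i)).
  apply/seteqP; split=> // t _.
  have [i _ Fi] : (\bigcup_i F i) (g t).1 by rewrite -FT.
  have [k _ Gk] : (\bigcup_i G i) (g t).2 by rewrite -GT.
  exists (maxn i k) => //; split.
    by move: Fi; exact/subsetPset/ndF/leq_maxl.
  by move: Gk; exact/subsetPset/ndG/leq_maxr.
move=> i; have [mFi Fi] := Foo i; have [mGi Gi] := Goo i; split.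
  by rewrite -[X in measurable X]setTI; apply: mg => //; exact: measurableX.
rewrite (_ : _ _ = (@lebesgue_measure R \x mu)%E (F i `*` G i)).
  by rewrite product_measure1E// lte_mul_pinfty// ge0_fin_numE.
rewrite /= /pushforward; congr ((_ \x _)%E _).
by apply/seteqP; split=> z; rewrite /preimage /mkset gK.
Qed.

HB.instance Definition _ m :=
  let: And4 h0 hge0 hs _ := lebesgue_tuple_sigma_finite_measure m in
  isMeasure.Build _ _ _ (@lebesgue_tuple m) h0 hge0 hs.

HB.instance Definition _ m :=
  let: And4 _ _ _ hf := lebesgue_tuple_sigma_finite_measure m in
  Measure_isSigmaFinite.Build _ _ _ (@lebesgue_tuple m) hf.

Lemma lebesgue_tuple_box m (A : 'I_m -> set R) :
  (forall i, measurable (A i)) ->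
  lebesgue_tuple [set t : m.-tuple R | forall i, A i (tnth t i)] =
  (\prod_(i < m) lebesgue_measure (A i))%E.
Proof.
elim: m A => [|m IH] A mA.
  rewrite big_ord0 /= diracE mem_set//; by case.
have mB : measurable
    [set t : m.-tuple R | forall i, A (lift ord0 i) (tnth t i)].
  rewrite (_ : mkset _ = \big[setI/setT]_(i < m)
      ((fun t => tnth t i) @^-1` A (lift ord0 i))).
    apply: bigsetI_measurable => i _; rewrite -[X in measurable X]setTI.
    by apply: measurable_tnth => //; exact: mA.
  apply/seteqP; split=> t /=.
    by move=> h; apply: (big_ind (fun S : set _ => S t)) => // i _; exact: h.
  by move=> + i; rewrite (bigD1 i)//= => -[].
rewrite big_ord_recl -IH => [|i]; last exact: mA.
apply: etrans (product_measure1E (@lebesgue_measure R)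
  (@lebesgue_tuple m) (mA ord0) mB).
rewrite [LHS]/= /pushforward.
congr ((_ \x _)%E _); apply/seteqP; split=> -[x t] /=.
  move=> h; split=> [|i] /=; first exact: (h ord0).
  by have := h (lift ord0 i); rewrite tnthS.
move=> [/= h0 h] i; have [j ->|->] := unliftP ord0 i; last exact: h0.
by rewrite tnthS; exact: h.
Qed.

End LebesgueTuple.

(* The vertices are 0, ..., n-1; an edge (i, i) is a self-loop. *)
Definition digraph (n : nat) := {set 'I_n * 'I_n}.

Section StructurallyDiagonalizable.
Variable R : realType.

(* The coordinates of x : R^|E| are the values of the starred entries, listed
   in the order of [enum E]. *)
Definition realization (n : nat) (E : digraph n) (x : #|E|.-tuple R) : 'M[R]_n :=
  \matrix_(i < n, j < n)
    (if (i, j) \in E then nth 0 x (index (i, j) (enum E)) else 0).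

Definition diagonalizable_over_C (n : nat) (A : 'M[R]_n) : Prop :=
  diagonalizable (map_mx (real_complex R) A).

Definition structurally_diagonalizable (n : nat) (E : digraph n) : Prop :=
  {ae @lebesgue_tuple R #|E|, forall x, diagonalizable_over_C (realization x)}.

Definition structurally_diagonalizable_digraphs (n : nat) : set (digraph n) :=
  [set E | structurally_diagonalizable E].

End StructurallyDiagonalizable.

Section RandomDigraph.
Variable R : realType.
Variables (n : nat) (p q : R).

Definition edge_prob (e : 'I_n * 'I_n) : R := if e.1 == e.2 then q else p.

(* The law of a digraph whose edges are present independently of each other;
   it is a probability mass function when p and q lie in [0, 1]. *)
Definition random_digraph_pmf (E : digraph n) : R :=
  \prod_(e : 'I_n * 'I_n)
    (if e \in E then edge_prob e else 1 - edge_prob e).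

(* P(G \in D) for G sampled from G(n, p, q) *)
Definition random_digraph_prob (D : set (digraph n)) : R :=
  \sum_(E : digraph n | E \in D) random_digraph_pmf E.

Lemma random_digraph_probT : random_digraph_prob setT = 1.
Proof.
rewrite /random_digraph_prob (eq_bigl xpredT) => [|E]; last by rewrite in_setT.
rewrite -bigA_distr big1// => e _; exact: subrKC.
Qed.

Lemma random_digraph_pmf_ge0 (E : digraph n) :
  0 <= p <= 1 -> 0 <= q <= 1 -> 0 <= random_digraph_pmf E.
Proof.
move=> /andP[p0 p1] /andP[q0 q1]; apply: prodr_ge0 => e _.
by rewrite /edge_prob; do 2!case: ifP => _; rewrite ?subr_ge0.
Qed.

End RandomDigraph.

(* Main.v *)
Require Import Defs.
From mathcomp Require Import all_boot all_order all_algebra.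
From mathcomp Require Import all_classical all_reals all_analysis.
From mathcomp Require Import complex ring lra zify.

(** The quantity subtracted from 1 is the asymptotic probability that there are
    exactly one vertex [i] without outgoing edges and exactly one vertex [j]
    without incoming edges, with [i != j]. In the structured matrix, row [i] is
    then the only zero row and column [j] the only zero column.

    With high probability such a digraph is not structurally diagonalizable.
    The columns other than [j] can be matched injectively to rows along edges.
    For a set of realizations of positive measure the kernel is then the line of
    the [j]-th basis vector, so that the [i]-th coordinate, which vanishes on
    the image, vanishes on the kernel too. Image and kernel do not span the
    space, and the matrix is not diagonalizable
    ([not_structurally_diagonalizable]).

    If the matching is missing, Hall's theorem gives a set of columns with too
    few neighbouring rows. A smallest such set, among rows and columns, has at
    most [n / 2] elements and one neighbour less than elements, and each of its
    neighbours has at least two edges to it ([matching_of_not_obstructed]). The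
    expected number of these configurations tends to 0, as in the theorem of
    Erdos and Renyi on perfect matchings of random bipartite graphs
    ([prob_obstructed_le]). Loops, which may have any probability, do no harm
    because a configuration has few places for them.

    For fixed [i] and [j], the cross of row [i] and column [j] is empty with
    probability close to [(1 - q)^2 (exp(-c) / n)^2]. Given this, the events that
    the other rows and columns are nonempty are increasing, and Harris'
    inequality bounds their conjunction from below by the product of their
    probabilities, which is close to [exp(- 2 (1 - q) exp(-c))]. The events for
    different pairs are disjoint; summing over the [n (n - 1)] pairs gives the
    main term, uniformly in [q] ([prob_structurally_diagonalizable_le]). *)

Import Order.TTheory GRing.Theory Num.Theory.
Import numFieldNormedType.Exports.

Set Implicit Arguments.
Unset Strict Implicit.
Unset Printing Implicit Defensive.

Local Open Scope ring_scope.

(** * Product measures on the subsets of a finite type *)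

Section ProductMeasure.
Variables (R : realFieldType) (I : finType).
Implicit Types (w : I -> R) (D U V : pred {set I}) (E S Z : {set I}).

(** The weight may vary with the element, so that conditioning on the absence
    of some elements does not leave the model: see [prob_delete]. *)
Definition pmf w E : R := \prod_e (if e \in E then w e else 1 - w e).

Definition prob w D : R := \sum_(E | D E) pmf w E.

Lemma probE w D : prob w D = \sum_E (D E)%:R * pmf w E.
Proof.
rewrite /prob big_mkcond; apply: eq_bigr => E _.
by case: (D E); rewrite ?mul1r ?mul0r.
Qed.

Lemma pmf_ge0 w E : (forall e, 0 <= w e <= 1) -> 0 <= pmf w E.
Proof.
move=> w01; apply: prodr_ge0 => e _; have /andP[? ?] := w01 e.
by case: ifP => _ //; rewrite subr_ge0.
Qed.

Lemma prob_ge0 w D : (forall e, 0 <= w e <= 1) -> 0 <= prob w D.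
Proof. by move=> w01; apply: sumr_ge0 => E _; apply: pmf_ge0. Qed.

Lemma probT w : prob w predT = 1.
Proof. by rewrite /prob -bigA_distr big1// => e _; exact: subrKC. Qed.

Lemma probC w D : prob w (predC D) = 1 - prob w D.
Proof. by rewrite -(probT w) {2}/prob (bigID D)/= addrC addrK. Qed.

Lemma prob_union (F : finType) (Q : pred F) (A : F -> pred {set I}) w D :
  (forall e, 0 <= w e <= 1) ->
  (forall E, D E -> exists2 f, Q f & A f E) ->
  prob w D <= \sum_(f | Q f) prob w (A f).
Proof.
move=> w01 DA; under eq_bigr do rewrite probE.
rewrite probE exchange_big/=; apply: ler_sum => E _.
rewrite -mulr_suml ler_wpM2r ?pmf_ge0//.
have [/DA[f Qf AfE]|_] := boolP (D E); last exact: sumr_ge0.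
by rewrite (bigD1 f)//= AfE lerDl sumr_ge0.
Qed.

Lemma prob_setU w D U V : (forall e, 0 <= w e <= 1) ->
  (forall E, D E -> U E || V E) -> prob w D <= prob w U + prob w V.
Proof.
move=> w01 DUV; pose A (b : bool) := if b then U else V.
have := @prob_union bool predT A w D w01; rewrite big_bool; apply => E /DUV.
by case/orP => h; [exists true|exists false].
Qed.

Lemma prob_disjoint (F : finType) (A : F -> pred {set I}) w D :
  (forall e, 0 <= w e <= 1) ->
  (forall f E, A f E -> D E) ->
  (forall f g E, A f E -> A g E -> f = g) ->
  \sum_f prob w (A f) <= prob w D.
Proof.
move=> w01 AD Ainj; under eq_bigr do rewrite probE.
rewrite probE exchange_big/=; apply: ler_sum => E _.
rewrite -mulr_suml ler_wpM2r ?pmf_ge0//.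
have [/existsP[f AfE]|/existsPn nA] := boolP [exists f, A f E]; last first.
  by rewrite big1// => f _; rewrite (negbTE (nA f)).
rewrite (bigD1 f)//= (AD f) ?AfE// big1 ?addr0// => g.
apply: contraNeq; rewrite pnatr_eq0 eqb0 negbK => AgE.
by rewrite (Ainj _ _ _ AfE AgE).
Qed.

(** Both sides come from the expansion of a product of sums over all subsets:
    prescribing the state of [e] deletes one of the two terms of its factor. *)
Lemma prob_cylinder S Z w : [disjoint S & Z] ->
  prob w [pred E : {set I} | (S \subset E) && [disjoint Z & E]] =
  \prod_(e in S) w e * \prod_(e in Z) (1 - w e).
Proof.
move=> SZ; pose g1 e := if e \in Z then 0 else w e.
pose g0 e := if e \in S then 0 else 1 - w e.
transitivity (\prod_e (g1 e + g0 e)).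
  rewrite bigA_distr /prob big_mkcond; apply: eq_bigr => E _ /=.
  case: ifPn => [/andP[/fintype.subsetP SE /pred0P ZE]|].
    apply: eq_bigr => e _; rewrite /g1 /g0.
    have := SE e; have := ZE e => /=; case: (e \in E) => /=.
      by rewrite andbT => -> .
    by case: (e \in S) => // _ /(_ isT).
  rewrite negb_and => /orP[/fintype.subsetPn[e eS eE]|/pred0Pn[e /andP[eZ eE]]].
    by rewrite (bigD1 e)//= (negbTE eE) /g0 eS mul0r.
  by rewrite (bigD1 e)//= [e \in E]eE /g1 [e \in Z]eZ mul0r.
rewrite (bigID (mem S))/=; congr (_ * _).
  by apply: eq_bigr => e eS; rewrite /g1 /g0 eS (disjointFr SZ eS) addr0.
rewrite (bigID (mem Z))/= [X in _ * X]big1 ?mulr1; last first.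
  by move=> e /andP[/negbTE eS /negbTE eZ]; rewrite /g1 /g0 eS eZ subrKC.
apply: eq_big => e.
  by case: (boolP (e \in Z)) => [/(disjointFl SZ)->|]; rewrite ?andbF.
by move=> /andP[/negbTE eS eZ]; rewrite /g1 /g0 eS eZ add0r.
Qed.

(** Conditioning on the absence of [Z] gives again a product measure, in which
    the elements of [Z] have weight 0. *)
Lemma prob_delete Z w D :
  prob w [pred E : {set I} | [disjoint Z & E] && D E] =
  \prod_(e in Z) (1 - w e) * prob (fun e => if e \in Z then 0 else w e) D.
Proof.
rewrite !probE mulr_sumr; apply: eq_bigr => E _ /=.
have [ZE/=|/pred0Pn[e /andP[/= eZ eE]]] := boolP [disjoint Z & E].
  rewrite mulrCA; congr (_ * _).
  rewrite /pmf (bigID (mem Z))/=; congr (_ * _).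
    by apply: eq_bigr => e eZ; rewrite (disjointFr ZE eZ).
  rewrite [RHS](bigID (mem Z))/= [X in _ = X * _]big1 ?mul1r.
    by apply: eq_bigr => e /negbTE eZ; rewrite eZ.
  by move=> e eZ; rewrite (disjointFr ZE eZ) eZ subr0.
rewrite mul0r /pmf [X in _ = _ * (_ * X)](bigD1 e)//=.
by rewrite [e \in E]eE [e \in Z]eZ mul0r !mulr0.
Qed.

Definition upclosed U := forall E E', E \subset E' -> U E -> U E'.

Let fixw w e x := [eta w with e |-> x].

Let pmf_fix w e x E : pmf (fixw w e x) E =
  (if e \in E then x else 1 - x) *
  \prod_(f | f != e) (if f \in E then w f else 1 - w f).
Proof.
rewrite /pmf (bigD1 e)//= eqxx; congr (_ * _).
by apply: eq_bigr => f /negbTE fe; rewrite /= fe.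
Qed.

Let prob_split w e D : prob w D =
  w e * prob (fixw w e 1) D + (1 - w e) * prob (fixw w e 0) D.
Proof.
rewrite /prob !mulr_sumr -big_split; apply: eq_bigr => E _ /=.
rewrite !pmf_fix /pmf (bigD1 e)//=.
by case: (e \in E); ring.
Qed.

(** Adding [e] to a set keeps it in [U], and transports the measure
    conditioned on the absence of [e] to the one conditioned on its presence. *)
Let prob_fix_le w e U : (forall e, 0 <= w e <= 1) -> upclosed U ->
  prob (fixw w e 0) U <= prob (fixw w e 1) U.
Proof.
move=> w01 upU.
have v01 x : (0 <= x <= 1) -> forall f, 0 <= fixw w e x f <= 1.
  by move=> x01 f /=; case: eqP.
have -> : prob (fixw w e 1) U = \sum_(E | U E && (e \in E)) pmf (fixw w e 1) E.
  rewrite /prob (bigID (fun E => e \in E))/= [X in _ + X]big1 ?addr0// => E.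
  by move=> /andP[_ /negbTE eE]; rewrite pmf_fix eE subrr mul0r.
rewrite (reindex_onto (fun E => e |: E) (fun E => E :\ e))/=; last first.
  by move=> E /andP[_ eE]; rewrite finset.setD1K.
rewrite /prob (bigID (fun E => e \in E))/= big1 ?add0r; last first.
  by move=> E /andP[_ eE]; rewrite pmf_fix eE mul0r.
rewrite [leRHS]big_mkcond [leLHS]big_mkcond; apply: ler_sum => E _.
case: ifPn => [/andP[UE eE]|_]; last first.
  by case: ifP => // _; apply: pmf_ge0; apply: v01; rewrite ler01 lexx.
rewrite (upU E) ?finset.subsetU1// finset.setU11 finset.setU1K// eqxx/=.
rewrite !pmf_fix finset.setU11 (negbTE eE).
rewrite subr0 !mul1r le_eqVlt; apply/orP; left; apply/eqP.
by apply: eq_bigr => f /negbTE fe; rewrite finset.in_setU1 fe.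
Qed.

(** Induction on the list [s] of the elements whose state is still random.
    Revealing the state of one of them replaces [w] by its two conditionings,
    for which the inequality is known; conditioned on presence, both events are
    more likely than conditioned on absence, so that averaging the products
    gives at least the product of the averages. *)
Let harris_seq (s : seq I) w U V : (forall e, 0 <= w e <= 1) ->
  (forall e, e \notin s -> (w e == 0) || (w e == 1)) ->
  upclosed U -> upclosed V ->
  prob w U * prob w V <= prob w (predI U V).
Proof.
elim: s w => [|e s IH] w w01 ws upU upV.
  (* nothing is random: the measure is concentrated at one set *)
  pose E0 := [set e | w e == 1].
  have pD D : prob w D = (D E0)%:R.
    rewrite probE (bigD1 E0)//= big1 ?addr0.
      rewrite /pmf big1 ?mulr1// => e _; rewrite inE.
      by have /orP[/eqP->|/eqP->] := ws e isT; rewrite ?eqxx// eq_sym oner_eq0 subr0.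
    move=> E /eqP EE0; apply/eqP; rewrite mulf_eq0; apply/orP; right.
    have /existsP[e eE] : [exists e, (e \in E) != (e \in E0)].
      apply: contra_notT EE0 => /existsPn h; apply/finset.setP => e.
      by apply/eqP; rewrite -[_ == _]negbK h.
    rewrite /pmf (bigD1 e)//= mulf_eq0; apply/orP; left.
    move: eE; rewrite inE; case: (e \in E).
      by have := ws e isT; case: (w e == 1) => //; rewrite orbF.
    by rewrite subr_eq0 [1 == _]eq_sym; case: (w e == 1).
  by rewrite !pD /=; case: (U E0); case: (V E0); rewrite ?mulr0 ?mul0r ?mulr1.
have IHx x : (0 <= x <= 1) -> (x == 0) || (x == 1) ->
  prob (fixw w e x) U * prob (fixw w e x) V <= prob (fixw w e x) (predI U V).
  move=> x01 xb; apply: IH => // f; first by rewrite /=; case: eqP.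
  rewrite /fixw /=; case: (f =P e) => // /eqP fe fs; apply: ws.
  by rewrite inE negb_or fe.
have i0 := IHx 0; have i1 := IHx 1; rewrite !lexx !eqxx ler01 orbT in i0 i1.
rewrite (prob_split w e U) (prob_split w e V) (prob_split w e (predI U V)).
have dU := prob_fix_le e w01 upU; have dV := prob_fix_le e w01 upV.
have /andP[we0 we1] := w01 e.
set a := prob _ U in i1 dU *; set b := prob _ U in i0 dU *.
set c := prob _ V in i1 dV *; set d := prob _ V in i0 dV *.
set s1 := prob _ _ in i1 *; set s0 := prob _ _ in i0 *.
apply: (@le_trans _ _ (w e * (a * c) + (1 - w e) * (b * d))); last first.
  by apply: lerD; apply: ler_wpM2l; rewrite ?subr_ge0// ?i0 ?i1.
rewrite -subr_ge0.
have -> : w e * (a * c) + (1 - w e) * (b * d) -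
  (w e * a + (1 - w e) * b) * (w e * c + (1 - w e) * d) =
  w e * (1 - w e) * ((a - b) * (c - d)) by ring.
by rewrite !mulr_ge0// subr_ge0.
Qed.

(** Harris' inequality: increasing events are positively correlated. It gives
    a lower bound for the probability that no further row or column is empty,
    without any computation of their joint law. *)
Lemma harris w U V : (forall e, 0 <= w e <= 1) -> upclosed U -> upclosed V ->
  prob w U * prob w V <= prob w (predI U V).
Proof.
by move=> w01; apply: (@harris_seq (enum I)) => // e; rewrite mem_enum inE.
Qed.

Lemma harris_all (J : finType) (Q : pred J) (A : J -> pred {set I}) w :
  (forall e, 0 <= w e <= 1) -> (forall j, upclosed (A j)) ->
  \prod_(j | Q j) prob w (A j) <=
  prob w [pred E | [forall (j | Q j), A j E]].
Proof.
move=> w01 upA.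
have -> : prob w [pred E | [forall (j | Q j), A j E]] =
    prob w (fun E => all (fun j => Q j ==> A j E) (enum J)).
  apply: eq_bigl => E /=; apply/forallP/allP => h j //.
  by apply: h; rewrite mem_enum.
rewrite big_mkcond -big_enum /=.
elim: (enum J) => [|j s IH]; first by rewrite big_nil (probT w).
rewrite big_cons/=.
have up_all : upclosed (fun E => all (fun j => Q j ==> A j E) s).
  move=> E E' EE' /allP h; apply/allP => k /h.
  by case: (Q k) => //=; apply: upA.
have up1 : upclosed (fun E => Q j ==> A j E).
  by move=> E E' EE'; case: (Q j) => //=; apply: upA.
apply: le_trans (harris w01 up1 up_all); apply: ler_pM => //.
- by case: ifP => // _; apply: prob_ge0.
- elim: s {IH up_all} => [|k s IH]; rewrite ?big_nil// big_cons mulr_ge0//.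
  by case: ifP => // _; apply: prob_ge0.
- by case: ifP => // _; rewrite (probT w).
Qed.

End ProductMeasure.

(** * A zero row and a zero column prevent diagonalizability *)

(** If [A] is diagonalizable, its image and its kernel span the whole space. The
    [i]-th coordinate vanishes on the image, because row [i] of [A] is zero, and
    on the kernel, which lies in the line of the [j]-th basis vector: it would
    be identically zero. In matrix form, row [i] of the matrix [B] whose columns
    are eigenvectors would be zero. *)
Lemma not_diagonalizable_of_kernel (F : fieldType) n (A : 'M[F]_n)
    (i j : 'I_n) :
  i != j -> (forall l, A i l = 0) ->
  (forall v : 'cV[F]_n, A *m v = 0 -> forall l, l != j -> v l 0 = 0) ->
  ~ diagonalizable A.
Proof.
move=> ij Ai0 kerA [P Pu /(similar_diagLR Pu)[D AE]].
have Bu : invmx P \in unitmx by rewrite unitmx_inv.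
rewrite conjumx// invmxK in AE; set B := invmx P in AE Bu.
have AB : A *m B = B *m diag_mx D by rewrite AE mulmxK.
have Bi0 l : B i l = 0.
  have : B i l * D 0 l = 0.
    have := congr1 (fun M : 'M[F]_n => M i l) AB.
    rewrite mul_mx_diag !mxE big1 => [<-//|m _]; by rewrite Ai0 mul0r.
  (* otherwise column l of B is an eigenvector for the eigenvalue 0 *)
  move=> /eqP; rewrite mulf_eq0 => /orP[/eqP//|/eqP Dl0].
  have : A *m col l B = 0.
    rewrite colE mulmxA AB -colE mul_mx_diag; apply/colP => m.
    by rewrite !mxE Dl0 mulr0.
  by move=> /kerA /(_ i ij); rewrite mxE.
have /(congr1 (fun M : 'M[F]_n => M i i)) := mulVmx Pu.
rewrite !mxE eqxx big1 => [/esym/eqP|m _]; first by rewrite oner_eq0.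
by rewrite -/B Bi0 mul0r.
Qed.

(** Strict diagonal dominance along the matching that sends column [l] to row
    [t l]: in the row matched to the largest coordinate of [v], the other terms
    are at most [n - 1] in number and too small to cancel the matched one. *)
Lemma dominant_kernel (R : realFieldType) n (A : 'M[R]_n) (j : 'I_n)
    (t : 'I_n -> 'I_n) (v : 'I_n -> R) :
  (forall l, A l j = 0) ->
  (forall l, l != j -> n%:R <= A (t l) l) ->
  (forall l m, l != j -> m != j -> m != l -> `|A (t l) m| <= 1) ->
  (forall r, \sum_l A r l * v l = 0) ->
  forall l, l != j -> v l = 0.
Proof.
move=> Aj big small Av l0 l0j; apply/eqP; rewrite -normr_le0.
have [l lj lmax] := @Order.TotalTheory.arg_maxP _ _ _ l0
  (fun l => l != j) (fun l => `|v l|) l0j.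
apply: le_trans (lmax _ l0j) _; rewrite leNgt; apply/negP => vl.
have := Av (t l); rewrite (bigD1 l)//= => /eqP; rewrite addr_eq0 => /eqP vE.
have : n%:R * `|v l| <= n.-1%:R * `|v l|.
  apply: (@le_trans _ _ `|A (t l) l * v l|).
    by rewrite normrM ler_wpM2r// (le_trans (big _ lj))// ler_norm.
  rewrite vE normrN (le_trans (ler_norm_sum _ _ _))//.
  rewrite -[n.-1](_ : #|predC1 l| = _); last first.
    by have := cardC1 l; rewrite card_ord.
  rewrite -sumr_const mulr_suml; apply: ler_sum => m ml; rewrite mul1r normrM.
  have [->|mj] := eqVneq m j; first by rewrite Aj normr0 mul0r.
  by rewrite -[leRHS]mul1r ler_pM//; [exact: small|exact: lmax].
rewrite ler_pM2r// ler_nat leqNgt ltn_predL => /negP; apply.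
by case: n l0 {A j t v Aj big small Av l0j l lj lmax vl vE} => [[]|].
Qed.

Section NotStructurallyDiagonalizable.
Variables (R : realType) (n : nat) (E : digraph n).
Local Open Scope classical_set_scope.

Lemma measurable_box m (A : 'I_m -> set R) :
  (forall i, measurable (A i)) ->
  measurable [set t : m.-tuple R | forall i, A i (tnth t i)].
Proof.
move=> mA; rewrite (_ : mkset _ = \big[setI/setT]_(i < m)
    ((fun t : m.-tuple R => tnth t i) @^-1` A i)).
  apply: bigsetI_measurable => i _; rewrite -[X in measurable X]setTI.
  by apply: measurable_tnth => //; exact: mA.
apply/seteqP; split=> t /=.
  by move=> h; apply: (big_ind (fun S : set _ => S t)) => // i _; exact: h.
by move=> + i; rewrite (bigD1 i)//= => -[].
Qed.

(** The box has measure 1, so that no null set contains it. *)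
Lemma unit_box_not_negligible (m : nat) (a : 'I_m -> R)
    (P : m.-tuple R -> Prop) :
  (forall t : m.-tuple R, (forall i, a i <= tnth t i <= a i + 1) -> ~ P t) ->
  ~ {ae @lebesgue_tuple R m, forall t, P t}.
Proof.
move=> boxP [N [mN N0 PN]].
pose A i := `[a i, a i + 1]%classic.
have mA i : measurable (A i) by exact: measurable_itv.
have : (lebesgue_tuple [set t : m.-tuple R | forall i, A i (tnth t i)] <=
    lebesgue_tuple N)%E.
  apply: le_measure; rewrite ?inE//; first exact: measurable_box.
  move=> t /= At; apply: PN => /=; apply: boxP => i.
  by have := At i; rewrite /A /= in_itv.
rewrite N0 lebesgue_tuple_box// big1 ?lee_fin ?ler10// => i _.
by rewrite /A lebesgue_measure_itv/= lte_fin ltrDl ltr01 -EFinD addrAC subrr add0r.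
Qed.

(** On the box where the matched entries lie between [n] and [n + 1] and the
    others between 0 and 1, the matching makes the realization diagonally
    dominant outside the empty column, so that its kernel is a line. The kernel
    of the complex matrix is controlled through real and imaginary parts. *)
Lemma not_structurally_diagonalizable (i j : 'I_n) (t : 'I_n -> 'I_n) :
  i != j -> (forall l, (i, l) \notin E) -> (forall l, (l, j) \notin E) ->
  {in [pred l | l != j] &, injective t} ->
  (forall l, l != j -> (t l, l) \in E) ->
  ~ structurally_diagonalizable R E.
Proof.
move=> ij iE jE tinj tE.
pose matched (e : 'I_n * 'I_n) := (e.2 != j) && (e.1 == t e.2).
pose a (k : 'I_#|E|) : R := if matched (enum_val k) then n%:R else 0.
apply: (@unit_box_not_negligible _ a) => x xa.
have xE e : e \in E -> (if matched e then n%:R else 0) <=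
    nth 0 x (index e (enum E)) <= (if matched e then (n%:R : R) else 0) + 1.
  move=> eE; have := xa (enum_rank_in eE e).
  rewrite /a enum_rankK_in// (tnth_nth 0).
  suff -> : enum_rank_in eE e = index e (enum E) :> nat by [].
  rewrite -[in RHS](enum_rankK_in eE eE) (enum_val_nth e) index_uniq ?enum_uniq//.
  by rewrite -cardE.
set A := realization x.
have A0 r l : (r, l) \notin E -> A r l = 0 by move=> /negbTE rl; rewrite mxE rl.
rewrite /diagonalizable_over_C; apply: (not_diagonalizable_of_kernel ij).
  by move=> l; rewrite mxE A0 ?raddf0.
have ker (v : 'I_n -> R) : (forall r, \sum_l A r l * v l = 0) ->
    forall l, l != j -> v l = 0.
  apply: (@dominant_kernel _ _ A _ t).
  - by move=> l; exact: A0.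
  - move=> l lj; rewrite mxE tE//; have := xE _ (tE _ lj).
    by rewrite /matched/= lj eqxx => /andP[].
  - move=> l m lj mj ml; rewrite mxE; case: ifP => [tlE|_]; last by rewrite normr0.
    have := xE _ tlE; rewrite /matched /= mj/=.
    have [/tinj e|_] := eqVneq (t l) (t m).
      by rewrite e ?eqxx// in ml.
    by rewrite add0r => /andP[x0 x1]; rewrite ger0_norm.
move=> v Av l lj.
have Avr r : \sum_l (A r l)%:C%C * v l 0 = 0.
  have := congr1 (fun u : 'cV_(n) => u r 0) Av; rewrite [in LHS]mxE [in RHS]mxE => h.
  by rewrite -[RHS]h; apply: eq_bigr => m _; rewrite [in RHS]mxE.
apply/eqP; rewrite eq_complex; apply/andP; split; apply/eqP => /=.
  apply: (ker (fun l => complex.Re (v l 0))) => // r.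
  have := congr1 (@complex.Re R) (Avr r); rewrite raddf_sum/= => h; rewrite -[RHS]h.
  by apply: eq_bigr => m _; case: (v m 0) => u w /=; rewrite mul0r subr0.
apply: (ker (fun l => complex.Im (v l 0))) => // r.
have := congr1 (@complex.Im R) (Avr r); rewrite raddf_sum/= => h; rewrite -[RHS]h.
by apply: eq_bigr => m _; case: (v m 0) => u w /=; rewrite mul0r addr0.
Qed.

End NotStructurallyDiagonalizable.

(** * Hall's theorem *)

Section Hall.
Variables (S T : finType).
Implicit Types (e : S -> T -> bool) (A X Y : {set S}).

Definition neighbours e X : {set T} := [set y | [exists x in X, e x y]].

Lemma neighboursP e X y :
  reflect (exists2 x, x \in X & e x y) (y \in neighbours e X).
Proof.
rewrite inE; apply: (iffP existsP) => [[x /andP[]]|[x xX xy]]; exists x => //.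
by rewrite xX.
Qed.

Lemma neighboursS e X Y : X \subset Y -> neighbours e X \subset neighbours e Y.
Proof.
move=> /fintype.subsetP XY; apply/fintype.subsetP => y /neighboursP[x xX xy].
by apply/neighboursP; exists x => //; apply: XY.
Qed.

Lemma neighboursU e X Y : neighbours e (X :|: Y) = neighbours e X :|: neighbours e Y.
Proof.
apply/finset.setP => y; rewrite finset.in_setU; apply/neighboursP/orP => [[x]|].
  by rewrite finset.in_setU => /orP[] ? ?; [left|right]; apply/neighboursP; exists x.
by move=> [] /neighboursP[x xX ?]; exists x; rewrite // finset.in_setU xX ?orbT.
Qed.

(** Hall's marriage theorem, by induction on [#|A|]. If some proper nonempty
    part of [A] has no more neighbours than elements, match it first: the rest
    still satisfies Hall's condition after these neighbours are removed. If
    there is none, match any element to any neighbour: the others lose at most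
    one neighbour, which they can spare. The function [t0] provides the values
    outside [A]. *)
Lemma hall e A (t0 : S -> T) :
  (forall X, X \subset A -> (#|X| <= #|neighbours e X|)%N) ->
  exists2 f : S -> T, {in A &, injective f} & forall x, x \in A -> e x (f x).
Proof.
elim: {A}_.+1 {-2}A e (ltnSn #|A|) => // m IH A e Am hallA.
have [/existsP[X /and4P[XA X0 XnA /eqP Xt]]|/existsPn tight] :=
  boolP [exists X : {set S}, [&& X \subset A, X != finset.set0, X != A &
                               #|X| == #|neighbours e X|]].
  have ltX : (#|X| < #|A|)%N by rewrite proper_card// finset.properEneq XnA.
  have [f finj fe] : exists2 f : S -> T, {in X &, injective f} &
      forall x, x \in X -> e x (f x).
    apply: IH; first exact: leq_trans ltX _.
    by move=> Y YX; apply: hallA; apply: fintype.subset_trans XA.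
  pose e' x y := e x y && (y \notin neighbours e X).
  have [g ginj ge] : exists2 f : S -> T, {in A :\: X &, injective f} &
      forall x, x \in A :\: X -> e' x (f x).
    apply: IH.
      apply: leq_trans (_ : #|A| <= m)%N; last by [].
      rewrite -(finset.cardsID X A) (finset.setIidPr XA) -[ltnLHS]add0n.
      by rewrite ltn_add2r card_gt0.
    move=> Y YAX.
    have YX : [disjoint X & Y].
      apply/pred0Pn => -[x /andP[/= xX xY]].
      by have := fintype.subsetP YAX _ xY; rewrite !inE xX.
    have : (#|X :|: Y| <= #|neighbours e (X :|: Y)|)%N.
      apply: hallA; rewrite finset.subUset XA (fintype.subset_trans YAX)//.
      exact: finset.subsetDl.
    rewrite neighboursU cardsU (disjoint_setI0 YX) cards0 subn0 Xt.
    have -> : neighbours e X :|: neighbours e Y =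
              neighbours e X :|: neighbours e' Y.
      apply/finset.setP => y; rewrite !finset.in_setU.
      have [//|yX/=] := boolP (y \in neighbours e X).
      apply/neighboursP/neighboursP => -[x xY]; rewrite /e' ?yX ?andbT => xy;
        by exists x => //; rewrite xy.
    move=> h; rewrite -(leq_add2l #|neighbours e X|); apply: leq_trans h _.
    by rewrite cardsU leq_subr.
  exists (fun x => if x \in X then f x else g x).
    have fX x : x \in X -> f x \in neighbours e X.
      by move=> xX; apply/neighboursP; exists x => //; apply: fe.
    have gX x : x \in A -> x \notin X -> g x \notin neighbours e X.
      move=> xA xX; have xAX : x \in A :\: X by rewrite !inE xX.
      by have /andP[] := ge _ xAX.
    move=> x y xA yA; case: ifPn => xX; case: ifPn => yX.
    - exact: finj.
    - by move=> fg; have := gX _ yA yX; rewrite -fg fX.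
    - by move=> fg; have := gX _ xA xX; rewrite fg fX.
    - by apply: ginj; rewrite !inE ?xX ?yX.
  move=> x xA; case: ifPn => xX; first exact: fe.
  have xAX : x \in A :\: X by rewrite !inE xX.
  by have /andP[] := ge _ xAX.
have [->|[x xA]] := finset.set_0Vmem A.
  by exists t0 => [x y|x]; rewrite inE.
have [y xy] : exists y, e x y.
  have := hallA [set x]; rewrite finset.sub1set xA finset.cards1 card_gt0 => /(_ isT).
  by move=> /set0Pn[y /neighboursP[z]]; rewrite inE => /eqP->; exists y.
pose e' z y' := e z y' && (y' != y).
have [g ginj ge] : exists2 f : S -> T, {in A :\ x &, injective f} &
    forall z, z \in A :\ x -> e' z (f z).
  apply: IH; first by rewrite (cardsD1 x) xA add1n in Am.
  move=> Y YAx; have [->|Y0] := eqVneq Y finset.set0; first by rewrite cards0.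
  have YA : Y \subset A by apply: fintype.subset_trans YAx _; apply: finset.subD1set.
  have xY : x \notin Y by apply/negP => /(fintype.subsetP YAx); rewrite !inE eqxx.
  have YnA : Y != A by apply: contraNneq xY => ->.
  have := tight Y; rewrite YA Y0 YnA /= => neqY.
  have ltY : (#|Y| < #|neighbours e Y|)%N by rewrite ltn_neqAle neqY hallA.
  rewrite -ltnS; apply: leq_trans ltY _; rewrite (cardsD1 y).
  apply: (@leq_trans (1 + #|neighbours e Y :\ y|)); first by rewrite leq_add2r leq_b1.
  rewrite add1n ltnS subset_leq_card//; apply/fintype.subsetP => z.
  rewrite finset.in_setD1 => /andP[zy /neighboursP[u uY uz]].
  by apply/neighboursP; exists u => //; rewrite /e' uz.
have gy z : z \in A -> z != x -> (z \in A :\ x) /\ (g z != y).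
  move=> zA zx; have zAx : z \in A :\ x by rewrite !inE zx.
  by split=> //; have /andP[] := ge _ zAx.
exists (fun z => if z == x then y else g z).
  move=> z u zA uA; have [->|zx] := eqVneq z x; have [->|ux] := eqVneq u x => //.
  - by have [_ /[swap] <-] := gy _ uA ux; rewrite eqxx.
  - by have [_ /[swap] ->] := gy _ zA zx; rewrite eqxx.
  - by apply: ginj; [have [] := gy _ zA zx|have [] := gy _ uA ux].
move=> z zA; have [->//|zx] := eqVneq z x.
by have [/ge/andP[]] := gy _ zA zx.
Qed.
End Hall.

(** * Obstructions to a matching *)

(** Here [e] is seen as a bipartite graph between rows and columns. A deficient
    set has fewer neighbours than elements, and [X] is smallest among the
    deficient sets of rows and of columns. Removing an element of [X] leaves a
    set that is not deficient, whence the exact number of neighbours, and the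
    fact that each of them has at least two neighbours in [X]. The columns
    outside its neighbourhood, except [j], form a deficient set with
    [#|S| - #|X|] elements, whence the bound on [#|X|]. *)
Lemma minimal_deficient_set (S : finType) (e : S -> S -> bool) (i j : S) (X : {set S}) :
  (forall c, ~~ e i c) -> (forall r, ~~ e r j) ->
  (forall r, r != i -> exists c, e r c) ->
  i \notin X -> (#|neighbours e X| < #|X|)%N ->
  (forall Y : {set S}, i \notin Y -> (#|neighbours e Y| < #|Y|)%N -> (#|X| <= #|Y|)%N) ->
  (forall Y : {set S}, j \notin Y -> (#|neighbours (fun c r => e r c) Y| < #|Y|)%N ->
     (#|X| <= #|Y|)%N) ->
  [/\ (1 < #|X|)%N, (#|X|.*2 <= #|S|)%N, #|X| = #|neighbours e X|.+1 &
    forall b, b \in neighbours e X -> (1 < #|[set t in X | e t b]|)%N].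
Proof.
move=> ei ej ne iX defX minr minc.
have [x0 x0X] : exists x, x \in X by apply/card_gt0P; apply: leq_ltn_trans defX.
have ltX x : x \in X -> ~~ (#|neighbours e (X :\ x)| < #|X :\ x|)%N.
  move=> xX; have iXx : i \notin X :\ x.
    by apply: contra iX; apply/fintype.subsetP/finset.subD1set.
  by apply/negP => /(minr _ iXx); rewrite (cardsD1 x X) xX ltnn.
have cardX : #|X| = #|neighbours e X|.+1.
  apply/eqP; rewrite eqn_leq defX andbT.
  have := ltX x0 x0X; rewrite -leqNgt => h.
  rewrite (cardsD1 x0) x0X add1n ltnS (leq_trans h)// subset_leq_card//.
  by apply: neighboursS; apply: finset.subD1set.
split=> //.
- rewrite cardX ltnS.
  have [|c xc] := ne x0; first by apply: contraNneq iX => <-.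
  by apply/card_gt0P; exists c; apply/neighboursP; exists x0.
- have jN : j \notin neighbours e X.
    by apply/neighboursP => -[x _]; rewrite (negbTE (ej x)).
  have cB : #|~: neighbours e X :\ j| = (#|S| - #|X|)%N.
    have := cardsD1 j (~: neighbours e X); rewrite finset.in_setC jN add1n.
    have := cardsC (neighbours e X); lia.
  have cN : (#|neighbours (fun c r => e r c) (~: neighbours e X :\ j)| < #|S| - #|X|)%N.
    apply: (@leq_ltn_trans #|~: X :\ i|); last first.
      have := cardsD1 i (~: X); rewrite finset.in_setC iX add1n.
      have := cardsC X; lia.
    apply/subset_leq_card/fintype.subsetP => r /neighboursP[c].
    rewrite !inE => /andP[_ /negP h] rc.
    rewrite (contraTneq _ rc)//=; last by move=> ->.
    by apply/negP => rX; apply: h; apply/existsP; exists r; rewrite rX.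
  have := minc (~: neighbours e X :\ j); rewrite cB => /(_ _ cN).
  rewrite !inE eqxx => /(_ isT); have := max_card (mem X); lia.
- move=> b /[dup] bN /neighboursP[x xX xb]; rewrite ltnNge; apply/negP => W1.
  have onlyx t : t \in X -> e t b -> t = x.
    move=> tX tb; apply/eqP/negPn/negP => tx; move: W1; rewrite leqNgt => /negP; apply.
    apply: (@leq_trans #|[set t; x]|); first by rewrite finset.cards2 tx.
    apply/subset_leq_card/fintype.subsetP => u; rewrite !inE.
    by case/orP => /eqP->; rewrite ?tX ?xX.
  have := ltX x xX; rewrite -leqNgt => h.
  have : (#|neighbours e (X :\ x)| <= #|neighbours e X :\ b|)%N.
    apply/subset_leq_card/fintype.subsetP => c /neighboursP[t].
    rewrite finset.in_setD1 => /andP[tx tX] tc; rewrite finset.in_setD1; apply/andP; split.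
      by apply: contra_neq tx => cb; apply: onlyx => //; rewrite -cb.
    by apply/neighboursP; exists t.
  have := cardsD1 b (neighbours e X); have := cardsD1 x X; rewrite bN xX; lia.
Qed.

Section Obstruction.
Variable n : nat.
Implicit Types (E : digraph n) (T B : {set 'I_n}).

(** The trace left by a smallest deficient set [T] of rows with neighbourhood
    [B]. That the columns of [B] have two neighbours in [T] is what makes it
    improbable for small [T]. *)
Definition obstruction T B E : bool :=
  [forall t in T, forall c, (c \notin B) ==> ((t, c) \notin E)] &&
  [forall b in B, (1 < #|[set t in T | (t, b) \in E]|)%N].

Definition obstruction_shape T B : bool :=
  [&& (1 < #|T|)%N, (#|T|.*2 <= n)%N & #|T| == #|B|.+1].

Definition obstructed E : bool :=
  [exists TB : {set 'I_n} * {set 'I_n},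
    obstruction_shape TB.1 TB.2 && obstruction TB.1 TB.2 E].

Definition transpose E : digraph n := [set e | (e.2, e.1) \in E].

Lemma obstructed_neighbours E (X : {set 'I_n}) :
  let e r c := (r, c) \in E in
  [/\ (1 < #|X|)%N, (#|X|.*2 <= #|'I_n|)%N, #|X| = #|neighbours e X|.+1 &
    forall b, b \in neighbours e X -> (1 < #|[set t in X | e t b]|)%N] ->
  obstructed E.
Proof.
move=> e [X1 Xn XN XB]; apply/existsP; exists (X, neighbours e X).
rewrite /obstruction_shape/= X1 -[n in (_ <= n)%N]card_ord Xn XN eqxx/=.
apply/andP; split.
  apply/forall_inP => t tX; apply/forallP => c; apply/implyP; apply: contra => tc.
  by apply/neighboursP; exists t.
by apply/forall_inP => b /XB.
Qed.

(** By Hall's theorem, a missing matching yields a deficient set of columns; a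
    smallest deficient set of rows or columns is then an obstruction in [E] or
    in its transpose. *)
Lemma matching_of_not_obstructed E (i j : 'I_n) :
  (forall l, (i, l) \notin E) -> (forall l, (l, j) \notin E) ->
  (forall r, r != i -> exists c, (r, c) \in E) ->
  (forall c, c != j -> exists r, (r, c) \in E) ->
  ~~ obstructed E -> ~~ obstructed (transpose E) ->
  exists2 t : 'I_n -> 'I_n, {in [pred l | l != j] &, injective t} &
    forall l, l != j -> (t l, l) \in E.
Proof.
move=> iE jE rE cE nE nE'.
pose e r c := (r, c) \in E; pose e' c r := e r c.
pose P k := [exists X : {set 'I_n}, (#|X| == k) &&
  ((i \notin X) && (#|neighbours e X| < #|X|)%N ||
   (j \notin X) && (#|neighbours e' X| < #|X|)%N)].
have [/existsP[X /andP[jX defX]]|/existsPn nodef] :=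
  boolP [exists X : {set 'I_n}, (j \notin X) && (#|neighbours e' X| < #|X|)%N].
  have exP : exists k, P k.
    by exists #|X|; apply/existsP; exists X; rewrite eqxx jX defX orbT.
  case: (ex_minnP exP) => k /existsP[Y /andP[/eqP Yk defY]] mink.
  have minr (Z : {set 'I_n}) : i \notin Z -> (#|neighbours e Z| < #|Z|)%N -> (#|Y| <= #|Z|)%N.
    by move=> iZ dZ; rewrite Yk mink//; apply/existsP; exists Z; rewrite eqxx iZ dZ.
  have minc (Z : {set 'I_n}) : j \notin Z -> (#|neighbours e' Z| < #|Z|)%N -> (#|Y| <= #|Z|)%N.
    by move=> iZ dZ; rewrite Yk mink//; apply/existsP; exists Z; rewrite eqxx iZ dZ orbT.
  exfalso; case/orP: defY => /andP[iY dY].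
    move/negP: nE; apply; apply: obstructed_neighbours.
    exact: minimal_deficient_set dY minr minc.
  have e'E : e' = (fun r c => (r, c) \in transpose E).
    by apply/funext => r; apply/funext => c; rewrite inE.
  move/negP: nE'; apply; apply: (@obstructed_neighbours _ Y) => /=.
  rewrite e'E in dY minc.
  apply: (@minimal_deficient_set _ _ j i) => //.
  - by move=> c; rewrite inE.
  - by move=> r; rewrite inE.
  - by move=> r /cE[c cr]; exists c; rewrite inE.
  - move=> Z iZ.
    have -> : neighbours (fun c r => (r, c) \in transpose E) Z = neighbours e Z.
      apply/finset.setP => r; apply/neighboursP/neighboursP => -[x xZ];
        by rewrite ?inE => xr; exists x; rewrite ?inE.
    exact: minr.
have [|t tinj tE] := @hall _ _ e' [set~ j] id.
  move=> X /fintype.subsetP jX; have := nodef X.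
  by rewrite negb_and negbK -leqNgt => /orP[/jX|//]; rewrite !inE eqxx.
exists t => [x y xj yj|l lj]; last by apply: tE; rewrite !inE.
by apply: tinj; rewrite !inE; [exact: xj|exact: yj].
Qed.
End Obstruction.

(** * Obstructions are improbable *)

Section ObstructionProbability.
Variable R : realType.

(** Rankin's trick: multiplied by [t ^+ m], the sum is dominated by the product
    of all [1 + t * x i], hence by [expR (t * W)]; [t] is chosen so that
    [t * W = m]. With all [x i] equal to 1 this bounds a binomial
    coefficient. *)
Lemma sum_prod_subsets_le (I : finType) (x : I -> R) (m : nat) (W : R) :
  (forall i, 0 <= x i) -> 0 < W -> \sum_i x i <= W -> (0 < m)%N ->
  \sum_(B : {set I} | #|B| == m) \prod_(i in B) x i <= (expR 1 * W / m%:R) ^+ m.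
Proof.
move=> x0 W0 xW m0; have m0' : 0 < m%:R :> R by rewrite ltr0n.
pose t := m%:R / W; have t0 : 0 < t by rewrite divr_gt0.
have -> : expR 1 * W / m%:R = expR 1 * t^-1 by rewrite /t invf_div mulrA.
rewrite exprMn exprVn -expRM_natl mulr1 ler_pdivlMr ?exprn_gt0//.
apply: (@le_trans _ _ (\prod_i (t * x i + 1))).
  rewrite bigA_distr/= mulr_suml [leLHS]big_mkcond; apply: ler_sum => B _.
  case: ifP => [/eqP Bm|_]; last first.
    by apply: prodr_ge0 => i _; case: ifP => _ //; rewrite mulr_ge0// ltW.
  by rewrite -big_mkcond/= big_split/= prodr_const Bm mulrC.
apply: (@le_trans _ _ (\prod_i expR (t * x i))).
  apply: ler_prod => i _; rewrite addr_ge0 ?(mulr_ge0 (ltW t0))//=.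
  by rewrite addrC expR_ge1Dx.
rewrite -expR_sum ler_expR -mulr_sumr.
apply: le_trans (ler_wpM2l (ltW t0) xW) _.
by rewrite /t divfK ?gt_eqF.
Qed.

Variables (n : nat) (p : R) (w : 'I_n * 'I_n -> R).
Hypotheses (p01 : 0 <= p <= 1) (w01 : forall e, 0 <= w e <= 1).
Hypothesis wE : forall a b, a != b -> w (a, b) = p.

(** Bound for the probability that column [b] has two edges coming from [T]: at
    most [#|T| ^ 2] pairs of rows if [b] is not in [T]. Otherwise one of the two
    edges can be the loop at [b], whose probability is not small, and only
    the other one is counted; there are few such columns. *)
Definition column_weight (T : {set 'I_n}) b : R :=
  if b \in T then #|T|%:R * p else (#|T|%:R * p) ^+ 2.

(** Union bound over the functions [f] that choose in every column of [B] two
    rows [f b] of [T], off the diagonal and different when [b] is not in [T],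
    equal otherwise. For each choice the edges [S f] are present and the
    off-diagonal edges [Z] from [T] to the complement of [B] are absent. *)
Lemma prob_obstruction (T B : {set 'I_n}) : (1 < #|T|)%N -> #|T| = #|B|.+1 ->
  prob w (obstruction T B) <=
  (1 - p) ^+ (#|T| * (n - #|T|)) * \prod_(b in B) column_weight T b.
Proof.
move=> T1 TB; have /andP[p0 p1] := p01.
have [i0 _] : exists x, x \in T by apply/card_gt0P; apply: ltnW.
pose Q b := [pred x : 'I_n * 'I_n | [&& x.1 \in T, x.2 \in T, x.1 != b, x.2 != b
  & (x.1 == x.2) == (b \in T)]].
pose S (f : {ffun 'I_n -> 'I_n * 'I_n}) : {set 'I_n * 'I_n} :=
  [set e | (e.2 \in B) && ((e.1 == (f e.2).1) || (e.1 == (f e.2).2))].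
pose Z : {set 'I_n * 'I_n} := [set e | [&& e.1 \in T, e.2 \notin B & e.1 != e.2]].
pose F := pfamily (i0, i0) (mem B) Q.
have obsF E : obstruction T B E ->
    exists2 f, f \in F & (S f \subset E) && [disjoint Z & E].
  move=> /andP[/forall_inP TBE /forall_inP BE].
  pose G b x := Q b x && ((x.1, b) \in E) && ((x.2, b) \in E).
  have exG b : b \in B -> exists x, G b x.
    move=> /BE; have [bT|bT] := boolP (b \in T).
      rewrite (cardsD1 b) => W1.
      have /card_gt0P[t] : (0 < #|[set t in T | (t, b) \in E] :\ b|)%N.
        by case: (_ \in _) W1 => //; apply: ltnW.
      by rewrite !inE => /and3P[tb tT tE]; exists (t, t); rewrite /G/= tT tb tE eqxx bT.
    move=> /card_gt1P[t [u [+ + tu]]]; rewrite !inE => /andP[tT tE] /andP[uT uE].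
    exists (t, u); rewrite /G/= tT uT tE uE (negbTE tu) (negbTE bT)/= andbT.
    by rewrite !(contraNneq _ bT)// => <-.
  pose f := [ffun b =>
    if b \in B then odflt (i0, i0) [pick x | G b x] else (i0, i0)].
  have fG b : b \in B -> G b (f b).
    move=> bB; rewrite ffunE bB; case: pickP => //= nG.
    by have [x] := exG _ bB; rewrite nG.
  exists f.
    apply/pfamilyP; split; last by move=> b /fG/andP[/andP[]].
    by apply/supportP => b bB; rewrite ffunE (negbTE bB).
  apply/andP; split.
    apply/fintype.subsetP => -[a b]; rewrite inE/= => /andP[/fG/andP[/andP[_ f1] f2]].
    by case/orP => /eqP->.
  apply/pred0Pn => -[[a b] /andP[/=]]; rewrite inE/= => /and3P[aT bB _].
  by have /forallP/(_ b)/implyP/(_ bB)/negbTE-> := TBE _ aT.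
apply: le_trans (prob_union w01 obsF) _ => /=.
have SZ f : [disjoint S f & Z].
  by apply/pred0Pn => -[e /andP[/=]]; rewrite !inE => /andP[-> _]; rewrite andbF.
under eq_bigr do rewrite (prob_cylinder _ (SZ _)).
rewrite -mulr_suml mulrC; apply: ler_pM.
- by apply: prodr_ge0 => e _; have /andP[_ ?] := w01 e; rewrite subr_ge0.
- by apply: sumr_ge0 => f _; apply: prodr_ge0 => e _; have /andP[] := w01 e.
- rewrite (eq_bigr (fun=> 1 - p)) => [|[a b]]; last first.
    by rewrite inE/= => /and3P[_ _ ab]; rewrite wE.
  rewrite prodr_const; apply: ler_wiXn2l; rewrite ?subr_ge0// ?gerBl//.
  have -> : #|Z| = (\sum_(t in T) #|~: B :\ t|)%N.
    rewrite -sum1_card.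
    under [RHS]eq_bigr do rewrite -sum1_card.
    rewrite pair_big_dep/=; apply: eq_bigl => -[a b].
    by rewrite !inE/= [a == b]eq_sym [(b \notin B) && _]andbC.
  rewrite -sum_nat_const; apply: leq_sum => t _.
  have := cardsD1 t (~: B); have := cardsC B; rewrite card_ord.
  have key (x y z m : nat) (b : bool) : (x + z = m -> z = b + y -> m - x.+1 <= y)%N.
    by case: b => /=; lia.
  by rewrite TB; apply: key.
- pose g b (x : 'I_n * 'I_n) := \prod_(a | (a == x.1) || (a == x.2)) w (a, b).
  have gE (f : {ffun 'I_n -> 'I_n * 'I_n}) :
      f \in F -> \prod_(e in S f) w e = \prod_(b in B) g b (f b).
    move=> fF; rewrite /g pair_big_dep/=.
    rewrite (reindex_onto (fun x : 'I_n * 'I_n => (x.2, x.1))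
      (fun x => (x.2, x.1)))/=; last by case.
    apply: eq_big => [[b a]|[b a] _] //=.
    by rewrite inE/= eqxx andbT.
  rewrite (eq_bigr _ gE) -(big_distr_big_dep (i0, i0) (mem B) Q g)/=; apply: ler_prod => b bB.
  have g0 x : 0 <= g b x by apply: prodr_ge0 => a _; have /andP[] := w01 (a, b).
  rewrite sumr_ge0 => [|x _]; last exact: g0.
  rewrite /column_weight /=; have [bT|bT] := boolP (b \in T).
    rewrite (eq_bigr (fun=> p)) => [|[a c]]; last first.
move=> /= /and5P[_ _ ab _ /eqP/eqP <-].
      by rewrite /g/= (big_pred1 a) ?wE// => c'; rewrite orbb.
    rewrite sumr_const -[leLHS]mulr_natl ler_wpM2r// ler_nat.
    apply: (@leq_trans #|[set (a, a) | a in T]|); last exact: leq_imset_card.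
    apply/subset_leq_card/fintype.subsetP => -[a c]; rewrite unfold_in/=.
    by move=> /and5P[aT _ _ _ /eqP/eqP <-]; apply/imsetP; exists a.
  rewrite (eq_bigr (fun=> p ^+ 2)) => [|[a c]]; last first.
    move=> /= /and5P[_ _ ab cb /eqP/negbT ac].
    rewrite /g/= (bigD1 a) ?eqxx//= (big_pred1 c) ?wE// => d /=.
    have [->|da] := eqVneq d a; first by rewrite andbF (negbTE ac).
    by rewrite andbT.
  rewrite sumr_const -[leLHS]mulr_natl exprMn ler_wpM2r ?sqr_ge0// -natrX ler_nat.
  rewrite -mulnn -cardsX; apply/subset_leq_card/fintype.subsetP => -[a c].
  by rewrite unfold_in/= !inE/= => /and5P[-> ->].
Qed.

Lemma sum_column_weight (T : {set 'I_n}) :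
  \sum_b column_weight T b <= #|T|%:R ^+ 2 * (p + n%:R * p ^+ 2).
Proof.
have /andP[p0 p1] := p01.
rewrite (bigID (mem T))/= mulrDr; apply: lerD.
  rewrite (eq_bigr (fun=> #|T|%:R * p)) => [|b bT]; last first.
    by rewrite /column_weight bT.
  by rewrite sumr_const -[leLHS]mulr_natl mulrA -expr2.
rewrite (eq_bigr (fun=> (#|T|%:R * p) ^+ 2)) => [|b bT]; last first.
  by rewrite /column_weight (negbTE bT).
rewrite sumr_const -[leLHS]mulr_natl [leRHS]mulrCA -exprMn ler_wpM2r ?sqr_ge0// ler_nat.
by rewrite -[leqRHS]card_ord max_card.
Qed.

End ObstructionProbability.

Section ObstructedBound.
Variable R : realType.
Variables (n : nat) (p : R) (w : 'I_n * 'I_n -> R).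
Hypotheses (p0 : 0 < p) (p1 : p <= 1) (w01 : forall e, 0 <= w e <= 1).
Hypothesis wE : forall a b, a != b -> w (a, b) = p.
Let L := n%:R * p.
Let K := 2 * expR 1 ^+ 2 * (L + L ^+ 2).
Hypothesis L1 : 1 <= L.

Let e1 : 1 <= expR 1 :> R.
Proof. by rewrite -expR0 ler_expR. Qed.

Let n0 : 0 < n%:R :> R.
Proof. by rewrite -(pmulr_lgt0 _ p0); apply: lt_le_trans L1. Qed.

Let K_ge : expR 1 <= K.
Proof.
have LL : 1 <= L + L ^+ 2 by rewrite -[leLHS]addr0 lerD// sqr_ge0.
have ee : expR 1 <= expR 1 ^+ 2 :> R by apply: ler_eXnr.
apply: le_trans ee _; rewrite /K -mulrA mulrCA ler_peMr ?sqr_ge0//.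
by nra.
Qed.

(** The first factor bounds the number of sets [T] of size [k], the second one
    the sum over [B] of the products of column weights: the powers of [k] and
    of [n] cancel up to one factor [n]. *)
Let binomial_estimate k : (1 < k)%N ->
  (expR 1 * n%:R / k%:R) ^+ k *
  (expR 1 * (k%:R ^+ 2 * (p + n%:R * p ^+ 2)) / k.-1%:R) ^+ k.-1 <=
  n%:R * K ^+ k.
Proof.
case: k => [//|m]; rewrite ltnS /= => m0; set k := m.+1.
have m0' : 0 < m%:R :> R by rewrite ltr0n.
have k0 : 0 < k%:R :> R by rewrite ltr0n.
have kS (x : R) : x ^+ k = x * x ^+ m := exprS x m.
rewrite !kS -[leLHS]mulrA -exprMn [leRHS]mulrA.
have K0 : 0 <= K by apply: le_trans K_ge; apply: expR_ge0.
apply: ler_pM.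
- by rewrite !mulr_ge0 ?expR_ge0 ?invr_ge0 ?ltW.
- by rewrite exprn_ge0// !mulr_ge0 ?expR_ge0 ?invr_ge0 ?addr_ge0 ?mulr_ge0 ?sqr_ge0 ?ltW.
- rewrite [expR 1 * _]mulrC -mulrA ler_wpM2l ?(ltW n0)//.
  apply: le_trans K_ge; rewrite ler_pdivrMr// ler_peMr ?expR_ge0//.
  by rewrite ler1n.
apply: lerXn2r; rewrite ?nnegrE//.
  by rewrite !mulr_ge0 ?expR_ge0 ?invr_ge0 ?addr_ge0 ?mulr_ge0 ?sqr_ge0 ?ltW.
have -> : expR 1 * n%:R / k%:R *
    (expR 1 * (k%:R ^+ 2 * (p + n%:R * p ^+ 2)) / m%:R)
  = expR 1 ^+ 2 * (L + L ^+ 2) * (k%:R / m%:R) :> R.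
  by rewrite /L; field; rewrite !gt_eqF.
rewrite /K -[leRHS]mulrA [leRHS]mulrC ler_wpM2l//.
  by rewrite mulr_ge0 ?sqr_ge0// addr_ge0 ?sqr_ge0// (le_trans _ L1).
by rewrite ler_pdivrMr// -natrM ler_nat /k mul2n -addnn -[m.+1]addn1 leq_add2l.
Qed.

Let level_le k : (1 < k)%N -> (k <= n)%N ->
  \sum_(T : {set 'I_n} | #|T| == k) \sum_(B : {set 'I_n} | #|B| == k.-1)
     (1 - p) ^+ (k * (n - k)) * \prod_(b in B) column_weight p T b <=
  n%:R * K ^+ k * expR (- (p * (k * (n - k))%:R)).
Proof.
move=> k1 kn; have k0 : 0 < k%:R :> R by rewrite ltr0n ltnW.
have km : (0 < k.-1)%N by case: (k) k1.
set c := (1 - p) ^+ _.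
have c0 : 0 <= c by rewrite exprn_ge0// subr_ge0.
have ce : c <= expR (- (p * (k * (n - k))%:R)).
  rewrite /c -mulNr mulrC expRM_natl; apply: lerXn2r; rewrite ?nnegrE ?subr_ge0 ?expR_ge0//.
  by rewrite expR_ge1Dx.
pose b := (expR 1 * (k%:R ^+ 2 * (p + n%:R * p ^+ 2)) / k.-1%:R) ^+ k.-1.
have p01 : 0 <= p <= 1 by rewrite ltW.
apply: (@le_trans _ _
  (\sum_(T : {set 'I_n} | #|T| == k) (\prod_(i in T) 1) * (c * b))).
  apply: ler_sum => T /eqP Tk; rewrite [X in _ <= X * _]big1// mul1r -mulr_sumr ler_wpM2l//.
  apply: sum_prod_subsets_le => //.
  - move=> i; rewrite /column_weight; case: ifP => _; rewrite ?sqr_ge0//.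
    by rewrite mulr_ge0// ltW.
  - by rewrite mulr_gt0 ?exprn_gt0// addr_gt0// mulr_gt0// exprn_gt0.
  - by rewrite -Tk; exact: sum_column_weight.
have b0 : 0 <= b.
  by rewrite exprn_ge0// !mulr_ge0 ?expR_ge0 ?invr_ge0 ?addr_ge0 ?mulr_ge0 ?sqr_ge0 ?ler0n// ltW.
rewrite -mulr_suml.
apply: (@le_trans _ _ ((expR 1 * n%:R / k%:R) ^+ k * (c * b))).
  rewrite ler_wpM2r ?mulr_ge0//; apply: sum_prod_subsets_le => //; last exact: ltnW.
  by rewrite sumr_const card_ord.
rewrite mulrCA mulrC; apply: ler_pM => //.
  by rewrite mulr_ge0// exprn_ge0// !mulr_ge0 ?expR_ge0 ?invr_ge0 ?ltW.
exact: binomial_estimate.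
Qed.

Lemma prob_obstructed_sum :
  prob w (@obstructed n) <=
  \sum_(k < n.+1 | (1 < k)%N && (k.*2 <= n)%N)
     n%:R * K ^+ k * expR (- (p * (k * (n - k))%:R)).
Proof.
have p01 : 0 <= p <= 1 by rewrite ltW.
apply: le_trans (prob_union (Q := fun TB => obstruction_shape TB.1 TB.2)
  (A := fun TB => obstruction TB.1 TB.2) w01 _) _.
  by move=> E /existsP[TB /andP[? ?]]; exists TB.
pose sz (TB : {set 'I_n} * {set 'I_n}) : 'I_n.+1 := inord #|TB.1|.
have szE TB : sz TB = #|TB.1| :> nat.
  by rewrite inordK// ltnS -[leqRHS]card_ord max_card.
rewrite (partition_big sz
  (fun k : 'I_n.+1 => (1 < k)%N && (k.*2 <= n)%N))/=; last first.
  by move=> TB /and3P[]; rewrite szE => -> ->.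
apply: ler_sum => k /andP[k1 k2].
have kn : (k <= n)%N by rewrite -ltnS.
apply: le_trans (level_le k1 kn).
rewrite [leRHS]pair_big_dep/=
  [leRHS](eq_bigl (fun TB => obstruction_shape TB.1 TB.2 && (sz TB == k))).
  apply: ler_sum => -[T B] /andP[/and3P[/= T1 _ /eqP TB] /eqP <-].
  by rewrite szE; exact: prob_obstruction.
move=> [T B]; rewrite -val_eqE/= szE /obstruction_shape/= andbC.
have [->|_] := eqVneq #|T| k; rewrite ?andbF// andbT k1 k2/= .
by rewrite andbT -[val k](@prednK k) ?eqSS 1?eq_sym// ltnW.
Qed.

Let h := K * expR (- (L / 4)).

(** Geometric series, split at [k = n / 4]. Below, an obstruction with [k] rows
    forces about [3 / 4 * L * k] in the exponent, and [k >= 2] suffices. Above,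
    only [L * k / 2] is left, but [k >= 6]. *)
Lemma prob_obstructed_le : (24 <= n)%N -> h <= 2^-1 ->
  prob w (@obstructed n) <= n%:R * expR (- L) * (4 * h ^+ 2 + 64 * h ^+ 6).
Proof.
move=> n24 h2; apply: le_trans prob_obstructed_sum _.
have K0 : 0 <= K by apply: le_trans K_ge; apply: expR_ge0.
have h0 : 0 <= h by rewrite mulr_ge0// expR_ge0.
have L0 : 0 <= L by apply: le_trans L1.
have exp1 x : 0 <= x -> expR (- x) <= 1 :> R.
  by move=> x0; rewrite -expR0 ler_expR oppr_le0.
set b := _ * (_ + _).
have b0 : 0 <= b.
  by rewrite !mulr_ge0 ?expR_ge0// addr_ge0// mulr_ge0// exprn_ge0.
have geo x m j : 0 <= x <= 2^-1 ->
    x ^+ (m + j) <= x ^+ m * 2 ^+ m * 2^-1 ^+ (m + j) :> R.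
  move=> /andP[x0 x2].
  have -> : x ^+ m * 2 ^+ m * 2^-1 ^+ (m + j) = x ^+ m * 2^-1 ^+ j :> R.
    rewrite exprD -mulrA [2 ^+ m * _]mulrA -exprMn divff ?pnatr_eq0//.
    by rewrite expr1n mul1r.
  by rewrite exprD ler_wpM2l ?exprn_ge0// lerXn2r// nnegrE// invr_ge0.
have term (k : 'I_n.+1) : (1 < k)%N && (k.*2 <= n)%N ->
    n%:R * K ^+ k * expR (- (p * (k * (n - k))%:R)) <= b * 2^-1 ^+ k.
  move=> /andP[k1 k2].
  have kn : (k <= n)%N by rewrite -ltnS.
  have kE (a : R) : K ^+ k * expR (- (a * k%:R)) = (K * expR (- a)) ^+ k.
    by rewrite [RHS]exprMn -[in RHS]expRM_natl mulrN [a * _]mulrC.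
  have expE : p * (k * (n - k))%:R = p * (n - k)%:R * k%:R.
    by rewrite natrM; ring.
  rewrite expE -mulrA kE.
  have [k4|k4] := leqP (k * 4)%N n.
    have pk : L * (3 / 4) <= p * (n - k)%:R.
      rewrite /L mulrAC mulrC ler_wpM2l ?(ltW p0)//.
      rewrite mulrC mulrAC ler_pdivrMr// -!natrM ler_nat; lia.
    pose x := h * expR (- (L / 2)).
    have x2 : 0 <= x <= 2^-1.
      rewrite mulr_ge0 ?expR_ge0//=; apply: le_trans h2.
      by rewrite ler_piMr// exp1// divr_ge0.
    have Kx : K * expR (- (p * (n - k)%:R)) <= x.
      rewrite /x /h -mulrA -expRD ler_wpM2l// ler_expR; lra.
    apply: (@le_trans _ _ (n%:R * x ^+ k)).
      rewrite ler_wpM2l ?(ltW n0)// lerXn2r// nnegrE.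
        by rewrite (mulr_ge0 K0) ?expR_ge0.
      by have /andP[] := x2.
    have -> : k = (2 + (k - 2))%N :> nat by rewrite subnKC.
    apply: (@le_trans _ _ (n%:R * (x ^+ 2 * 2 ^+ 2 * 2^-1 ^+ (2 + (k - 2))))).
      by rewrite ler_wpM2l ?(ltW n0)// geo.
    rewrite mulrA ler_wpM2r ?exprn_ge0 ?invr_ge0// /b.
    have -> : x ^+ 2 = h ^+ 2 * expR (- L).
      by rewrite exprMn -expRM_natl; congr (_ * expR _); lra.
    rewrite -![leRHS]mulrA ler_wpM2l ?(ltW n0)//.
    have : 0 <= expR (- L) * h ^+ 6 by rewrite mulr_ge0 ?expR_ge0 ?exprn_ge0.
    by move: (expR _) (h ^+ 6) (h ^+ 2) => a y z ay; rewrite -subr_ge0; lra.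
  have k6 : (6 <= k)%N by lia.
  have pk : L / 2 <= p * (n - k)%:R.
    rewrite /L mulrAC mulrC ler_wpM2l ?(ltW p0)//.
    by rewrite ler_pdivrMr// -!natrM ler_nat; lia.
  pose x := h * expR (- (L / 4)).
  have x2 : 0 <= x <= 2^-1.
    rewrite mulr_ge0 ?expR_ge0//=; apply: le_trans h2.
    by rewrite ler_piMr// exp1// divr_ge0.
  have Kx : K * expR (- (p * (n - k)%:R)) <= x.
    rewrite /x /h -mulrA -expRD ler_wpM2l// ler_expR; lra.
  apply: (@le_trans _ _ (n%:R * x ^+ k)).
    rewrite ler_wpM2l ?(ltW n0)// lerXn2r// nnegrE.
      by rewrite (mulr_ge0 K0) ?expR_ge0.
    by have /andP[] := x2.
  have -> : k = (6 + (k - 6))%N :> nat by rewrite subnKC.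
  apply: (@le_trans _ _ (n%:R * (x ^+ 6 * 2 ^+ 6 * 2^-1 ^+ (6 + (k - 6))))).
    by rewrite ler_wpM2l ?(ltW n0)// geo.
  rewrite mulrA ler_wpM2r ?exprn_ge0 ?invr_ge0// /b.
  have -> : x ^+ 6 = h ^+ 6 * (expR (- L) * expR (- (L / 2))).
    by rewrite exprMn -expRM_natl -expRD; congr (_ * expR _); lra.
  rewrite -![leRHS]mulrA ler_wpM2l ?(ltW n0)//.
  have := exprn_ge0 6 h0; have := sqr_ge0 h; have := expR_ge0 (- L).
  have : expR (- (L / 2)) <= 1 by rewrite exp1// divr_ge0.
  set u := expR (- (L / 2)); set v := expR (- L); move=> u1 v0 h20 h60.
  have : h ^+ 6 * (v * u) <= h ^+ 6 * v by rewrite ler_wpM2l// ler_piMr.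
  have : 0 <= v * h ^+ 2 by rewrite mulr_ge0.
  lra.
apply: le_trans (ler_sum _ term) _; rewrite -mulr_sumr ler_piMr//.
apply: (@le_trans _ _ (\sum_(0 <= k < n.+1) (1 < k)%N%:R * 2^-1 ^+ k)).
  rewrite big_mkord [leLHS]big_mkcond; apply: ler_sum => k _.
  by case: (1 < k)%N; rewrite /= ?mul1r ?mul0r//;
    case: ifP => // _; rewrite exprn_ge0// invr_ge0.
suff : \sum_(0 <= k < n.+1) (1 < k)%N%:R * 2^-1 ^+ k <= 1 - 2^-1 ^+ n :> R.
  by move=> h'; apply: le_trans h' _; rewrite gerBl exprn_ge0// invr_ge0.
elim: n => [|m IH]; first by rewrite big_nat1 mul0r expr0 subrr.
rewrite big_nat_recr//=; apply: le_trans (lerD IH (_ : _ <= 2^-1 ^+ m.+1)) _.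
  by case: (1 < _)%N; rewrite ?mul1r ?mul0r// exprn_ge0// invr_ge0.
by rewrite exprS; lra.
Qed.
End ObstructedBound.

(** * The main term at finite size *)

Section LonelySourceAndSink.
Variable R : realType.
Variables (n : nat) (p q : R).
Hypotheses (p01 : 0 <= p <= 1) (q01 : 0 <= q <= 1).
Let w : 'I_n * 'I_n -> R := edge_prob p q.
Let u := 1 - q.
Let b := (1 - p) ^+ (n - 2).

Let w01 e : 0 <= w e <= 1.
Proof. by rewrite /w /edge_prob; case: ifP. Qed.

Let p'0 : 0 <= 1 - p. Proof. by have /andP[] := p01; rewrite subr_ge0. Qed.
Let p'1 : 1 - p <= 1. Proof. by have /andP[] := p01; rewrite gerBl. Qed.
Let u0 : 0 <= u. Proof. by have /andP[] := q01; rewrite subr_ge0. Qed.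
Let u1 : u <= 1. Proof. by have /andP[] := q01; rewrite gerBl. Qed.
Let b0 : 0 <= b. Proof. by rewrite exprn_ge0. Qed.
Let b1 : b <= 1. Proof. by rewrite exprn_ile1. Qed.
Let ub1 : u * b <= 1. Proof. by rewrite mulr_ile1. Qed.

Definition only_sink_and_source (i j : 'I_n) (E : digraph n) : bool :=
  [&& i != j, [forall l, (i, l) \notin E], [forall l, (l, j) \notin E],
      [forall (r | r != i), [exists c, (r, c) \in E]] &
      [forall (c | c != j), [exists r, (r, c) \in E]]].

Let cross (i j : 'I_n) : {set 'I_n * 'I_n} := [set e | (e.1 == i) || (e.2 == j)].

(** The cross of row [i] and column [j] contains exactly two loops. *)
Let prod_cross i j : i != j ->
  u ^+ 2 * (1 - p) ^+ n.*2 <= \prod_(e in cross i j) (1 - w e).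
Proof.
move=> ij.
rewrite (bigD1 (i, i)) ?inE ?eqxx//= (bigD1 (j, j)) ?inE ?eqxx ?orbT//=; last first.
  by apply: contra ij => /eqP[->].
rewrite {1 2}/w /edge_prob/= !eqxx mulrA -expr2 ler_wpM2l ?sqr_ge0//.
rewrite (eq_bigr (fun=> 1 - p)) => [|[a c]]; last first.
  rewrite inE/= => /andP[/andP[/orP[]/eqP-> h1 h2]]; rewrite /w/edge_prob/=.
    by rewrite ifN//; apply: contraNneq h1 => <-.
  by rewrite ifN//; apply: contraNneq h2 => <-.
rewrite prodr_const; apply: ler_wiXn2l => //.
apply: (@leq_trans
  #|finset.setX [set i] [set: 'I_n] :|: finset.setX [set: 'I_n] [set j]|).
  apply/subset_leq_card/fintype.subsetP => -[a c]; rewrite unfold_in/= !inE/=.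
  by move=> /andP[/andP[+ _] _]; rewrite andbT.
rewrite cardsU; apply: leq_trans (leq_subr _ _) _.
by rewrite !cardsX !finset.cards1 finset.cardsT card_ord mul1n muln1 addnn.
Qed.

Let cross_weight i j e := if e \in cross i j then 0 else w e.

Let cross_weight01 i j e : 0 <= cross_weight i j e <= 1.
Proof. by rewrite /cross_weight; case: ifP => _ //; rewrite lexx ler01. Qed.

(** [f] enumerates a row or a column. Its entry [k] is the loop, and its entry
    [k'] is the only one in the cross, so that it is already known to be
    absent. The loop is one of the remaining entries unless [k = k']. *)
Let prob_line_nonempty i j (k k' : 'I_n) (f : 'I_n -> 'I_n * 'I_n) :
  injective f -> w (f k) = q -> f k' \in cross i j ->
  (forall c, c != k' -> f c \notin cross i j) ->
  (forall c, c != k -> w (f c) = p) ->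
  1 - (if k == k' then 1 else u) * b <=
  prob (cross_weight i j) [pred E : {set 'I_n * 'I_n} | [exists c, f c \in E]].
Proof.
move=> finj wk fk' fc wc.
pose Z := [set f c | c in 'I_n].
have -> : prob (cross_weight i j)
      [pred E : {set 'I_n * 'I_n} | [exists c, f c \in E]] =
    prob (cross_weight i j) (predC [pred E : {set 'I_n * 'I_n} |
      (finset.set0 \subset E) && [disjoint Z & E]]).
  apply: eq_bigl => E /=; rewrite finset.sub0set/= disjoint_subset.
  apply/existsP/subsetPn => [[c cE]|[e]].
    by exists (f c); [apply/imsetP; exists c|rewrite inE negbK].
  by move=> /imsetP[c _ ->]; rewrite inE negbK => cE; exists c.
rewrite probC prob_cylinder; last first.
  by rewrite disjoint_subset; apply/fintype.subsetP => e; rewrite inE.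
rewrite finset.big_set0 mul1r lerD2l lerN2 big_imset/=; last first.
  by move=> ? ? _ _; apply: finj.
rewrite (bigD1 k')//= /cross_weight fk' subr0 mul1r.
have [kk'|kk'] := eqVneq k k'.
  rewrite mul1r (eq_bigr (fun=> 1 - p)) => [|c ck']; last first.
    by rewrite (negbTE (fc _ ck')) wc// kk'.
  rewrite prodr_const; apply: ler_wiXn2l => //.
  by rewrite cardC1 card_ord -subn1 leq_sub2l.
rewrite (bigD1 k)//= (negbTE (fc _ kk')).
rewrite wk ler_wpM2l// (eq_bigr (fun=> 1 - p)) => [|c /andP[ck' ck]]; last first.
  by rewrite (negbTE (fc _ ck')) wc.
rewrite prodr_const; apply: ler_wiXn2l => //.
apply: (@leq_trans #|~: [set k; k']|).
  have := cardsC [set k; k']; rewrite card_ord finset.cards2 kk' => h.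
  by rewrite leq_subLR h.
apply/subset_leq_card/fintype.subsetP => c.
by rewrite !inE negb_or => /andP[ck ck']; apply/andP.
Qed.

Let lower := u ^+ 2 * (1 - p) ^+ n.*2 * ((1 - u * b) ^+ n * (1 - b)) ^+ 2.

(** Among the rows other than [i], row [j] plays a special role: its loop lies
    in the deleted column. Likewise for column [i], whose loop lies in the
    deleted row. *)
Let prod_lines (k : 'I_n) (k' : 'I_n) (g : 'I_n -> R) :
  (forall r, r != k -> 1 - (if r == k' then 1 else u) * b <= g r) ->
  (forall r, g r <= 1) -> k != k' ->
  (1 - u * b) ^+ n * (1 - b) <= \prod_(r | r != k) g r.
Proof.
move=> gl g1 kk'; have ub0 : 0 <= 1 - u * b by rewrite subr_ge0.
have b'0 : 0 <= 1 - b by rewrite subr_ge0.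
rewrite (bigD1 k') 1?eq_sym//= mulrC; apply: ler_pM => //.
- by rewrite exprn_ge0.
- by have := gl k'; rewrite eq_sym eqxx mul1r; apply.
apply: (@le_trans _ _ (\prod_(r < n | (r != k) && (r != k')) (1 - u * b))).
  rewrite prodr_const; apply: ler_wiXn2l => //.
    by rewrite gerBl mulr_ge0.
  by rewrite -[leqRHS]card_ord max_card.
apply: ler_prod => r /andP[rk rk']; rewrite ub0/=.
by have := gl _ rk; rewrite (negbTE rk').
Qed.

(** Conditionally on the absence of the edges of the cross, the events that the
    other rows and columns are nonempty are increasing, and Harris' inequality
    bounds their intersection by a product. *)
Lemma prob_only_sink_and_source i j : i != j ->
  lower <= prob w (only_sink_and_source i j).
Proof.
move=> ij.
pose J := ('I_n + 'I_n)%type.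
pose Q (x : J) := match x with inl r => r != i | inr c => c != j end.
pose A (x : J) (E : {set 'I_n * 'I_n}) := match x with
  | inl r => [exists c, (r, c) \in E] | inr c => [exists r, (r, c) \in E] end.
have upA x : upclosed (A x).
  move=> E E' /fintype.subsetP EE'; case: x => x /existsP[y] xy;
  by apply/existsP; exists y; apply: EE'.
have -> : prob w (only_sink_and_source i j) =
  prob w [pred E : {set 'I_n * 'I_n} |
    [disjoint cross i j & E] && [forall (x | Q x), A x E]].
  apply: eq_bigl => E /=; rewrite /only_sink_and_source ij/=.
  apply/and4P/andP => [|[ijE /forall_inP rcE]].
    move=> [/forallP iE /forallP jE /forall_inP rE /forall_inP cE].
    split; last by apply/forall_inP => -[r|c]; [exact: rE|exact: cE].
    apply/pred0P => -[a c]; rewrite /= inE/=.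
    apply/negP => /andP[/orP[]/eqP->]; first by rewrite (negbTE (iE c)).
    by rewrite (negbTE (jE a)).
  split; last 2 first.
  - by apply/forall_inP => r ri; exact: (rcE (inl r)).
  - by apply/forall_inP => c cj; exact: (rcE (inr c)).
  - by apply/forallP => l; rewrite (disjointFr ijE)// inE eqxx.
  - by apply/forallP => l; rewrite (disjointFr ijE)// inE eqxx orbT.
rewrite prob_delete; apply: ler_pM.
- by rewrite mulr_ge0 ?sqr_ge0// exprn_ge0.
- by rewrite sqr_ge0.
- exact: prod_cross.
apply: le_trans (harris_all Q (cross_weight01 i j) upA).
rewrite big_sumType/= expr2.
have g1 D : prob (cross_weight i j) D <= 1.
  rewrite -(probT (cross_weight i j)) -subr_ge0.
  have := prob_ge0 (predC D) (cross_weight01 i j); rewrite probC.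
  by rewrite probT.
have m0 : 0 <= (1 - u * b) ^+ n * (1 - b).
  by rewrite mulr_ge0 ?exprn_ge0// subr_ge0.
apply: ler_pM => //.
- apply: (@prod_lines i j) => // r ri.
  apply: (@prob_line_nonempty i j r j (fun c => (r, c))).
  + by move=> c d [].
  + by rewrite /w /edge_prob/= eqxx.
  + by rewrite inE eqxx orbT.
  + by move=> c cj; rewrite inE/= negb_or ri.
  + by move=> c cr; rewrite /w /edge_prob/= eq_sym (negbTE cr).
- apply: (@prod_lines j i) => //; last by rewrite eq_sym.
  move=> c cj; apply: (@prob_line_nonempty i j c i (fun r => (r, c))).
  + by move=> r s [].
  + by rewrite /w /edge_prob/= eqxx.
  + by rewrite inE eqxx.
  + by move=> r ri; rewrite inE/= negb_or ri.
  + by move=> r rc; rewrite /w /edge_prob/= (negbTE rc).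
Qed.

Lemma prob_transpose D : prob w (fun E => D (transpose E)) = prob w D.
Proof.
have trK : involutive (@transpose n).
  by move=> E; apply/finset.setP => -[a c]; rewrite !inE.
rewrite [RHS]/prob (reindex_inj (inv_inj trK)); apply: eq_bigr => E _.
pose sw (e : 'I_n * 'I_n) := (e.2, e.1).
have swK : involutive sw by case.
rewrite [RHS]/pmf (reindex_inj (inv_inj swK)); apply: eq_bigr => -[a c] _.
by rewrite inE/= /w /edge_prob/= eq_sym.
Qed.

(** The events [only_sink_and_source i j] are disjoint, and each of them, unless
    there is an obstruction, excludes structural diagonalizability. *)
Lemma prob_structurally_diagonalizable_le :
  random_digraph_prob p q (@structurally_diagonalizable_digraphs R n) <=
  1 - n%:R * n.-1%:R * lower + 2 * prob w (@obstructed n).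
Proof.
pose D (E : digraph n) := E \in @structurally_diagonalizable_digraphs R n.
have -> : random_digraph_prob p q
    (@structurally_diagonalizable_digraphs R n) = prob w D by [].
pose V (E : digraph n) := [exists f : 'I_n * 'I_n, only_sink_and_source f.1 f.2 E].
have VE : n%:R * n.-1%:R * lower <= prob w V.
  apply: (@le_trans _ _
    (\sum_(f : 'I_n * 'I_n) prob w (only_sink_and_source f.1 f.2))).
    rewrite -(pair_bigA _ (fun i j => prob w (only_sink_and_source i j)))/=.
    rewrite -mulrA mulr_natl -[n in X in X <= _]card_ord -sumr_const.
    apply: ler_sum => i _; rewrite mulr_natl (bigD1 i)//=.
    rewrite -[leLHS]add0r lerD ?prob_ge0//.
rewrite -(cardC1 i).
    rewrite -sumr_const; apply: ler_sum => j; rewrite inE/= => ij.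
    by apply: prob_only_sink_and_source; rewrite eq_sym.
  apply: prob_disjoint => //.
    by move=> f E fE; apply/existsP; exists f.
  move=> [i j] [i' j'] E /and5P[/= _ /forallP iE /forallP jE _ _].
  move=> /and5P[/= _ _ _ /forall_inP rE /forall_inP cE]; congr pair.
    apply/eqP/negPn/negP => /rE/existsP[c]; by rewrite (negbTE (iE c)).
  by apply/eqP/negPn/negP => /cE/existsP[c]; rewrite (negbTE (jE c)).
pose O (E : digraph n) := obstructed E || obstructed (transpose E).
have VD : prob w V <= prob w (predC D) + prob w O.
  apply: prob_setU => // E /existsP[[i j]] /and5P[/= ij /forallP iE /forallP jE].
  move=> /forall_inP rE /forall_inP cE.
  apply/orP; have [|nO] := boolP (O E); [by right|left].
  move: nO; rewrite negb_or => /andP[nO nO'].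
  have rE' r : r != i -> exists c, (r, c) \in E by move=> /rE/existsP.
  have cE' c : c != j -> exists r, (r, c) \in E by move=> /cE/existsP.
  have [t tinj tE] := matching_of_not_obstructed iE jE rE' cE' nO nO'.
  by apply/negP => /set_mem; apply: not_structurally_diagonalizable ij iE jE tinj tE.
have OE : prob w O <= 2 * prob w (@obstructed n).
  rewrite mulr_natl mulr2n -[X in _ <= _ + X]prob_transpose.
  by apply: prob_setU => // E.
move: VE VD OE; rewrite (probC w D).
move: (prob w V) (prob w D) (prob w O) (prob w _) (_ * lower) => v d o ob l.
by lra.
Qed.
End LonelySourceAndSink.

Local Open Scope classical_set_scope.
Local Open Scope ring_scope.

(** * Asymptotics *)

Lemma limn_esup_le0 (R : realType) (f : nat -> R) (g : nat -> R) :
  (\forall n \near \oo, f n <= g n) -> g n @[n --> \oo] --> 0 ->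
  (limn_esup (fun n => (f n)%:E) <= 0)%E.
Proof.
move=> fg g0; apply/lee_addgt0Pr => d d0; rewrite add0e.
have fd : \forall n \near \oo, f n <= d.
  near=> n; apply: (@le_trans _ _ (g n)); first by near: n.
  by near: n; apply: cvgr_le g0 _ d0.
apply: (@le_trans _ _ (ereal_sup [set (f x)%:E | x in [set n | f n <= d]])).
  by apply: ereal_inf_lbound; exists [set n | f n <= d].
by apply: ge_ereal_sup => _ [n /= fnd <-]; rewrite lee_fin.
Unshelve. all: by end_near. Qed.

(** From [1 + y <= expR y] at [y = x / (1 - x)], which is at most
    [x + 2 * x ^+ 2]. *)
Lemma expR_le_onem (R : realType) (x : R) :
  0 <= x <= 2^-1 -> expR (- (x + 2 * x ^+ 2)) <= 1 - x.
Proof.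
move=> /andP[x0 x2]; have x1 : 0 < 1 - x by lra.
have xE : x / (1 - x) <= x + 2 * x ^+ 2.
  have x'0 : 0 <= 1 - 2 * x by lra.
  have h : 0 <= x ^+ 2 * (1 - 2 * x) by rewrite mulr_ge0 ?sqr_ge0.
  by rewrite ler_pdivrMr//; lra.
apply: (@le_trans _ _ (expR (- (x / (1 - x))))); first by rewrite ler_expR lerN2.
rewrite expRN -[leRHS]invrK lef_pV2 ?posrE ?invr_gt0 ?expR_gt0//.
apply: (@le_trans _ _ (1 + x / (1 - x))); last exact: expR_ge1Dx.
rewrite le_eqVlt; apply/orP; left; apply/eqP.
by field; rewrite gt_eqF.
Qed.

Section Asymptotics.
Variables (R : realType) (c : R) (eps p : nat -> R).
Hypothesis heps : eps n @[n --> \oo] --> 0.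
Hypothesis hp : forall n : nat, (0 < n)%N -> p n = (ln n%:R + c + eps n) / n%:R.
Let L n := n%:R * p n.

Let LE n : (0 < n)%N -> L n = ln n%:R + c + eps n.
Proof. by move=> n0; rewrite /L hp// mulrC divfK// pnatr_eq0 -lt0n. Qed.

Lemma mean_degree_cvgy : L n @[n --> \oo] --> +oo.
Proof.
apply/cvgryPge => A; near=> n.
have n0 : (0 < n)%N by near: n; exact: nbhs_infty_gt.
have e1 : `|eps n| < 1 by near: n; exact: cvgr0_norm_lt.
have An : expR (A - c + 1) <= n%:R by near: n; exact: nbhs_infty_ger.
rewrite LE//.
have : A - c + 1 <= ln n%:R by rewrite -[leLHS]expRK ler_ln// posrE ?expR_gt0 ?ltr0n.
by move: e1; rewrite ltr_norml => /andP[]; lra.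
Unshelve. all: by end_near. Qed.

Let nexpL n : (0 < n)%N -> n%:R * expR (- L n) = expR (- (c + eps n)).
Proof.
move=> n0; rewrite LE// -addrA opprD expRD mulrA.
rewrite (expRN (ln n%:R)) [expR (ln _)]lnK ?posrE ?ltr0n//.
by rewrite divff ?mul1r// pnatr_eq0 -lt0n.
Qed.

Let nexpL_cvg : n%:R * expR (- L n) @[n --> \oo] --> expR (- c).
Proof.
apply: (@cvg_trans _ (expR (- (c + eps n)) @[n --> \oo])).
  apply: near_eq_cvg; near=> n.
  by rewrite nexpL//; near: n; exact: nbhs_infty_gt.
apply: continuous_cvg; first exact: continuous_expR.
by apply: cvgN; rewrite -[X in _ --> X]addr0; apply: cvgD => //; exact: cvg_cst.
Unshelve. all: by end_near. Qed.

(** [p n], [n%:R * p n ^+ 2] and the quantity [h n] below are bounded by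
    multiples of [s n], which is at most [384 / L n] by the cubic term of the
    exponential series. *)
Let s n := L n ^+ 2 * expR (- (L n / 4)).

Let s_cvg0 : s n @[n --> \oo] --> 0.
Proof.
have hi : 384 * (L n)^-1 @[n --> \oo] --> 0.
  rewrite -(mulr0 384); apply: cvgM; first exact: cvg_cst.
  apply/gtr0_cvgV0; last exact: mean_degree_cvgy.
  by apply: (cvgryPgt _).1; exact: mean_degree_cvgy.
apply: (squeeze_cvgr _ (cvg_cst 0) hi).
near=> n; rewrite /s mulr_ge0 ?sqr_ge0 ?expR_ge0//=.
have L0 : 0 < L n by near: n; apply: (cvgryPgt _).1; exact: mean_degree_cvgy.
have x0 : 0 <= L n / 4 by rewrite divr_ge0// ltW.
have h : L n ^+ 3 / 384 <= expR (L n / 4).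
  apply: (@le_trans _ _ (1 + (L n / 4) ^+ 3 / 3`!%:R)); last exact: expR_ge1Dxn.
  have -> : 3`!%:R = 6 :> R by [].
  suff -> : (L n / 4) ^+ 3 / 6 = L n ^+ 3 / 384 by rewrite lerDr.
  by field.
rewrite expRN ler_pdivrMr ?expR_gt0//.
apply: (@le_trans _ _ (384 / L n * (L n ^+ 3 / 384))); last first.
  by rewrite ler_wpM2l// mulr_ge0// invr_ge0 ltW.
by rewrite le_eqVlt; apply/orP; left; apply/eqP; field; rewrite gt_eqF.
Unshelve. all: by end_near. Qed.

Let L1 : \forall n \near \oo, 1 <= L n.
Proof. by apply: (cvgryPge _).1; exact: mean_degree_cvgy. Qed.

Let s_bound (k : nat) : (0 < k <= 2)%N ->
  \forall n \near \oo, 0 <= L n ^+ k * expR (- (L n)) <= s n.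
Proof.
move=> k12; near=> n.
have L1n : 1 <= L n by near: n.
have L0n : 0 <= L n by apply: le_trans L1n.
rewrite mulr_ge0 ?exprn_ge0 ?expR_ge0//=; apply: ler_pM; rewrite ?exprn_ge0 ?expR_ge0//.
  by apply: ler_weXn2l => //; case/andP: k12.
by rewrite ler_expR; lra.
Unshelve. all: by end_near. Qed.

Let Lexp_cvg0 (k : nat) : (0 < k <= 2)%N -> L n ^+ k / n%:R @[n --> \oo] --> 0.
Proof.
move=> k12.
have h : expR (- (- (c + eps n))) * s n @[n --> \oo] --> 0.
  rewrite -(mulr0 (expR (- (- (c + 0))))); apply: cvgM => //.
  apply: continuous_cvg; first exact: continuous_expR.
  by do 2 apply: cvgN; apply: cvgD => //; exact: cvg_cst.
apply: (squeeze_cvgr _ (cvg_cst 0) h).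
near=> n.
have n0 : (0 < n)%N by near: n; exact: nbhs_infty_gt.
have n0' : 0 < n%:R :> R by rewrite ltr0n.
have -> : L n ^+ k / n%:R = expR (- (- (c + eps n))) * (L n ^+ k * expR (- L n)).
  by rewrite expRN -nexpL//; field; rewrite gt_eqF ?expR_gt0// gt_eqF.
have /andP[a b] : 0 <= L n ^+ k * expR (- (L n)) <= s n by near: n; exact: s_bound.
by rewrite mulr_ge0 ?expR_ge0//= ler_wpM2l ?expR_ge0.
Unshelve. all: by end_near. Qed.

Lemma edge_prob_cvg0 : p n @[n --> \oo] --> 0.
Proof.
apply: cvg_trans (Lexp_cvg0 (k := 1) isT); apply: near_eq_cvg; near=> n.
have n0 : n%:R != 0 :> R by rewrite pnatr_eq0 -lt0n; near: n; exact: nbhs_infty_gt.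
by rewrite expr1 /L mulrC mulKf.
Unshelve. all: by end_near. Qed.

Let np2_cvg0 : n%:R * p n ^+ 2 @[n --> \oo] --> 0.
Proof.
apply: cvg_trans (Lexp_cvg0 (k := 2) isT); apply: near_eq_cvg; near=> n.
have n0 : n%:R != 0 :> R by rewrite pnatr_eq0 -lt0n; near: n; exact: nbhs_infty_gt.
by rewrite /L; field.
Unshelve. all: by end_near. Qed.

Lemma edge_prob_near : \forall n \near \oo, 0 < p n <= 2^-1.
Proof.
have half0 : (0 : R) < 2^-1 by rewrite invr_gt0.
near=> n; apply/andP; split.
  have n0 : (0 < n)%N by near: n; exact: nbhs_infty_gt.
  rewrite -(@pmulr_rgt0 _ n%:R) ?ltr0n//; apply: (@lt_le_trans _ _ 1) => //.
  by near: n.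
by near: n; apply: cvgr_le edge_prob_cvg0 _ half0.
Unshelve. all: by end_near. Qed.

Let z n := n%:R * (1 - p n) ^+ n.

Let z_cvg : z n @[n --> \oo] --> expR (- c).
Proof.
have lb : n%:R * expR (- L n) * expR (- (2 * (n%:R * p n ^+ 2))) @[n --> \oo] --> expR (- c).
  rewrite [X in _ --> X](_ : _ = expR (- c) * expR (- (2 * 0))); last first.
    by rewrite mulr0 oppr0 expR0 mulr1.
  apply: cvgM => //; apply: continuous_cvg; first exact: continuous_expR.
  by apply: cvgN; apply: cvgM => //; exact: cvg_cst.
apply: (squeeze_cvgr _ lb nexpL_cvg); near=> n.
have /andP[p0 p2] : 0 < p n <= 2^-1 by near: n; exact: edge_prob_near.
have p'0 : 0 <= 1 - p n by lra.
rewrite /z -mulrA; apply/andP; split; rewrite ler_wpM2l//.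
  rewrite -expRD (_ : - L n + _ = n%:R * (- (p n + 2 * p n ^+ 2))); last by rewrite /L; ring.
  rewrite expRM_natl; apply: lerXn2r; rewrite ?nnegrE ?expR_ge0//.
  by rewrite expR_le_onem// p2 ltW.
rewrite /L -mulrN expRM_natl; apply: lerXn2r; rewrite ?nnegrE ?expR_ge0//.
exact: expR_ge1Dx.
Unshelve. all: by end_near. Qed.

Let b n := (1 - p n) ^+ (n - 2).
Let la n := n%:R * b n.

Let la_cvg : la n @[n --> \oo] --> expR (- c).
Proof.
have h : z n * ((1 - p n)^-1 * (1 - p n)^-1) @[n --> \oo] --> expR (- c).
  have pV : (1 - p n)^-1 @[n --> \oo] --> (1 - 0 : R)^-1.
    apply: cvgV; first by rewrite subr0 oner_neq0.
    by apply: cvgB => //; [exact: cvg_cst|exact: edge_prob_cvg0].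
  rewrite -[X in _ --> X]mulr1; apply: cvgM => //.
  rewrite [X in _ --> X](_ : 1 = (1 - 0 : R)^-1 * (1 - 0)^-1); last first.
    by rewrite subr0 invr1 mulr1.
  exact: cvgM.
apply: cvg_trans h; apply: near_eq_cvg; near=> n.
have /andP[p0 p2] : 0 < p n <= 2^-1 by near: n; exact: edge_prob_near.
have n2 : (2 <= n)%N by near: n; exact: nbhs_infty_ge.
have p'0 : 1 - p n != 0 by rewrite gt_eqF//; lra.
rewrite /z /la /b.
have -> : (1 - p n) ^+ n = (1 - p n) ^+ (n - 2) * (1 - p n) ^+ 2.
  by rewrite -exprD subnK.
by field.
Unshelve. all: by end_near. Qed.

Let inv_cvg0 : n%:R^-1 @[n --> \oo] --> (0 : R).
Proof.
apply/gtr0_cvgV0; last exact: cvgr_idn.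
by near=> n; rewrite ltr0n; near: n; exact: nbhs_infty_gt.
Unshelve. all: by end_near. Qed.

Let b_cvg0 : b n @[n --> \oo] --> 0.
Proof.
have h : la n * n%:R^-1 @[n --> \oo] --> 0.
  by rewrite -(mulr0 (expR (- c))); exact: cvgM.
apply: cvg_trans h; apply: near_eq_cvg; near=> n.
have n0 : n%:R != 0 :> R by rewrite pnatr_eq0 -lt0n; near: n; exact: nbhs_infty_gt.
by rewrite /la mulrC mulKf.
Unshelve. all: by end_near. Qed.

(** [d] collects the factors of the main term that do not depend on [q], and
    the error made when the factor depending on [q] is replaced by its
    approximation: its limit gives an estimate that is uniform in [q]. *)
Let d n := z n ^+ 2 * (1 - n%:R^-1) * (1 - b n) ^+ 2 *
  expR (- (2 * (`|la n - expR (- c)| + 2 * (la n * b n)))).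

Let d_cvg : d n @[n --> \oo] --> expR (- (2 * c)).
Proof.
have -> : expR (- (2 * c)) = expR (- c) ^+ 2 * (1 - 0) * (1 - 0) ^+ 2 *
    expR (- (2 * (`|expR (- c) - expR (- c)| + 2 * (expR (- c) * 0)))).
  rewrite subrr normr0 !mulr0 addr0 mulr0 oppr0 !addr0 expR0 expr1n !mulr1.
  by rewrite -expRM_natl mulrN.
have c1 (u : nat -> R) :
    u n @[n --> \oo] --> 0 -> 1 - u n @[n --> \oo] --> (1 - 0 : R).
  by move=> u0; apply: cvgB => //; exact: cvg_cst.
apply: cvgM; first apply: cvgM; first apply: cvgM.
- exact: (cvgM z_cvg z_cvg).
- exact: c1.
- exact: (cvgM (c1 _ b_cvg0) (c1 _ b_cvg0)).
- apply: continuous_cvg; first exact: continuous_expR.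
  apply: cvgN; apply: cvgM; first exact: cvg_cst.
  apply: cvgD; last by apply: cvgM; [exact: cvg_cst|exact: cvgM].
  by apply: cvg_norm; apply: cvgB => //; exact: cvg_cst.
Qed.

Let h n := 2 * expR 1 ^+ 2 * (L n + L n ^+ 2) * expR (- (L n / 4)).

Let h_cvg0 : h n @[n --> \oo] --> 0.
Proof.
have h0 : 4 * expR 1 ^+ 2 * s n @[n --> \oo] --> 0.
  by rewrite -(mulr0 (4 * expR 1 ^+ 2)); apply: cvgM => //; exact: cvg_cst.
apply: (squeeze_cvgr _ (cvg_cst 0) h0); near=> n.
have L1n : 1 <= L n by near: n.
have L0n : 0 <= L n by apply: le_trans L1n.
rewrite /h /s; apply/andP; split.
  by rewrite !mulr_ge0 ?expR_ge0 ?addr_ge0 ?sqr_ge0.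
rewrite mulrA ler_wpM2r ?expR_ge0//.
have -> : 4 * expR 1 ^+ 2 * L n ^+ 2 =
  2 * expR 1 ^+ 2 * (L n ^+ 2 + L n ^+ 2) by ring.
rewrite ler_wpM2l ?mulr_ge0 ?sqr_ge0// lerD2r expr2 ler_peMl//.
Unshelve. all: by end_near. Qed.

Variable q : nat -> R.
Hypothesis hq : forall n : nat, 0 <= q n <= 1.

(** With [y = u * b n + 2 * (u * b n) ^+ 2], the [n]-th power of [1 - u * b n] is
    at least [expR (- (n%:R * y))], and [n%:R * b n] is compared with its
    limit. *)
Let main_term n u : (1 < n)%N -> 0 < p n <= 2^-1 -> b n <= 2^-1 ->
  0 <= u <= 1 ->
  u ^+ 2 * expR (- (2 * u * expR (- c))) * d n <=
  n%:R * n.-1%:R * (u ^+ 2 * (1 - p n) ^+ n.*2 *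
    ((1 - u * b n) ^+ n * (1 - b n)) ^+ 2).
Proof.
move=> n1 /andP[p0 p2] b2 /andP[u0 u1].
have p'0 : 0 <= 1 - p n by lra.
have b0 : 0 <= b n by rewrite exprn_ge0.
have nz : n%:R != 0 :> R by rewrite pnatr_eq0 -lt0n ltnW.
have n1E : n.-1%:R = n%:R * (1 - n%:R^-1) :> R.
  by rewrite mulrBr mulr1 divff// -subn1 natrB// ltnW.
have zE : n%:R * n.-1%:R * (1 - p n) ^+ n.*2 = z n ^+ 2 * (1 - n%:R^-1).
  by rewrite n1E /z -mul2n mulnC exprM; ring.
have -> : n%:R * n.-1%:R * (u ^+ 2 * (1 - p n) ^+ n.*2 *
     ((1 - u * b n) ^+ n * (1 - b n)) ^+ 2) =
   u ^+ 2 * (z n ^+ 2 * (1 - n%:R^-1)) * (1 - b n) ^+ 2 *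
     ((1 - u * b n) ^+ n) ^+ 2.
  by rewrite -zE; ring.
have -> : u ^+ 2 * expR (- (2 * u * expR (- c))) * d n =
   u ^+ 2 * (z n ^+ 2 * (1 - n%:R^-1)) * (1 - b n) ^+ 2 *
   (expR (- (2 * u * expR (- c))) *
    expR (- (2 * (`|la n - expR (- c)| + 2 * (la n * b n))))).
  by rewrite /d; ring.
have nV : 0 <= 1 - n%:R^-1 :> R by rewrite subr_ge0 invf_le1 ?ler1n ?ltr0n// ltnW.
apply: ler_wpM2l.
  exact: mulr_ge0 (mulr_ge0 (sqr_ge0 _) (mulr_ge0 (sqr_ge0 _) nV)) (sqr_ge0 _).
rewrite -expRD -exprM mulnC exprM.
have ub0 : 0 <= u * b n by rewrite mulr_ge0.
have ubb : u * b n <= b n by rewrite ler_piMl.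
have ub : 0 <= u * b n <= 2^-1 by rewrite ub0 (le_trans ubb).
have := expR_le_onem ub.
set y := u * b n + _ => hy.
apply: (@le_trans _ _ ((expR (- y) ^+ 2) ^+ n)); last first.
  rewrite lerXn2r ?nnegrE ?sqr_ge0// lerXn2r ?nnegrE ?expR_ge0//.
  exact: le_trans (expR_ge0 _) hy.
rewrite -!expRM_natl ler_expR.
have la0 : 0 <= la n by rewrite mulr_ge0.
have dist : u * (la n - expR (- c)) <= `|la n - expR (- c)|.
  by apply: le_trans (ler_norm _) _; rewrite normrM ger0_norm// ler_piMl.
have quad : n%:R * (u * b n) ^+ 2 <= la n * b n.
  rewrite /la -mulrA -expr2 ler_wpM2l// lerXn2r ?nnegrE//.
have yE : n%:R * (2 * - y) = - (2 * (u * la n)) - 4 * (n%:R * (u * b n) ^+ 2).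
  by rewrite /y /la; ring.
rewrite yE; lra.
Qed.

Let h_near : \forall n \near \oo, h n <= 2^-1.
Proof.
have half0 : (0 : R) < 2^-1 by rewrite invr_gt0.
exact: cvgr_le h_cvg0 _ half0.
Qed.

Let b_near : \forall n \near \oo, b n <= 2^-1.
Proof.
have half0 : (0 : R) < 2^-1 by rewrite invr_gt0.
exact: cvgr_le b_cvg0 _ half0.
Qed.

Let g n := `|expR (- (2 * c)) - d n| +
  2 * (n%:R * expR (- L n) * (4 * h n ^+ 2 + 64 * h n ^+ 6)).

Let g_cvg0 : g n @[n --> \oo] --> 0.
Proof.
have h2 : h n ^+ 2 @[n --> \oo] --> 0.
  by rewrite -(mulr0 (0 : R)); exact: (cvgM h_cvg0 h_cvg0).
have h4 : h n ^+ 2 * h n ^+ 2 @[n --> \oo] --> 0.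
  by rewrite -(mulr0 (0 : R)); exact: (cvgM h2 h2).
have h6 : h n ^+ 6 @[n --> \oo] --> 0.
  have : h n ^+ 2 * h n ^+ 2 * h n ^+ 2 @[n --> \oo] --> 0.
    by rewrite -(mulr0 (0 : R)); exact: (cvgM h4 h2).
  by apply: cvg_trans; apply: near_eq_cvg; near=> n; rewrite -!exprD.
rewrite [X in _ --> X](_ : _ = `|expR (- (2 * c)) - expR (- (2 * c))| +
    2 * (expR (- c) * (4 * 0 + 64 * 0))); last first.
  by rewrite subrr normr0 !mulr0 addr0 mulr0 mulr0 addr0.
apply: cvgD; first by apply: cvg_norm; apply: cvgB => //; exact: cvg_cst.
apply: cvgM; first exact: cvg_cst.
apply: cvgM => //.
by apply: cvgD; apply: cvgM => //; exact: cvg_cst.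
Unshelve. all: by end_near. Qed.

Lemma random_digraph_prob_excess : exists2 g : nat -> R,
  g n @[n --> \oo] --> 0 & \forall n \near \oo,
    random_digraph_prob (p n) (q n) (@structurally_diagonalizable_digraphs R n)
    - (1 - (1 - q n) ^+ 2 * expR (- (2 * (1 - q n) * expR (- c)))
           * expR (- (2 * c))) <= g n.
Proof.
exists g; first exact: g_cvg0.
near=> n.
have pn : 0 < p n <= 2^-1 by near: n; exact: edge_prob_near.
have /andP[p0 p2] := pn.
have p1 : p n <= 1 by lra.
have p01 : 0 <= p n <= 1 by rewrite p1 ltW.
have n24 : (24 <= n)%N by near: n; exact: nbhs_infty_ge.
have b2 : b n <= 2^-1 by near: n.
have h2 : h n <= 2^-1 by near: n.
have L1n : 1 <= L n by near: n.
have /andP[q0 q1] := hq n.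
have u01 : 0 <= 1 - q n <= 1 by rewrite subr_ge0 q1 gerBl.
have mt := main_term (leq_trans (isT : 1 < 24)%N n24) pn b2 u01.
have w01 (e : 'I_n * 'I_n) : 0 <= edge_prob (p n) (q n) e <= 1.
  by rewrite /edge_prob; case: ifP => _.
have wE x y : x != y -> @edge_prob R n (p n) (q n) (x, y) = p n.
  by rewrite /edge_prob/= => /negbTE->.
have ob := prob_obstructed_le p0 p1 w01 wE L1n n24 h2.
have sd := prob_structurally_diagonalizable_le n p01 (hq n).
have u0 : 0 <= (1 - q n) ^+ 2 * expR (- (2 * (1 - q n) * expR (- c))) <= 1.
  rewrite mulr_ge0 ?sqr_ge0 ?expR_ge0//= mulr_ile1 ?sqr_ge0 ?expR_ge0//.
    by rewrite exprn_ile1// ?subr_ge0// gerBl.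
  rewrite -[leRHS]expR0 ler_expR oppr_le0 mulr_ge0 ?expR_ge0// mulr_ge0//.
  by rewrite subr_ge0.
move: mt sd ob u0; rewrite /= -/(b n) -/(L n) -/(h n) /g.
set v := _ ^+ 2 * expR _; set ob := prob _ _; set bd := _ * (_ + _).
set lo := (_ * _ * (_ * _ * _ ^+ 2)); set pr := random_digraph_prob _ _ _.
move=> mt sd ob_le /andP[v0 v1].
have : v * (expR (- (2 * c)) - d n) <= `|expR (- (2 * c)) - d n|.
  by apply: le_trans (ler_norm _) _; rewrite normrM ger0_norm// ler_piMl.
rewrite mulrBr; move: mt sd ob_le.
by lra.
Unshelve. all: by end_near. Qed.

End Asymptotics.

Theorem theorem4p8 (R : realType) (c : R) (eps p q : nat -> R)
    (heps : eps n @[n --> \oo] --> 0)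
    (hp : forall n : nat, (0 < n)%N -> p n = (ln n%:R + c + eps n) / n%:R)
    (hq : forall n : nat, 0 <= q n <= 1) :
  (limn_esup (fun n : nat =>
     (random_digraph_prob (p n) (q n)
        (@structurally_diagonalizable_digraphs R n)
      - (1 - (1 - q n) ^+ 2 * expR (- (2 * (1 - q n) * expR (- c)))
             * expR (- (2 * c))))%:E) <= 0)%E.
Proof.
have [g g0 gle] := random_digraph_prob_excess heps hp hq.
exact: limn_esup_le0 gle g0.
Qed.
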